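(* Let $\rho>0$, $T>0$, $\theta\ge0$ and $x,y\in\mathbb{R}$. For $N\ge2$ let $(\bm\xi^{(N)},\bm\eta^{(N)})$ be the unique Nash equilibrium on the grid $\mathbb{T}_N$ with initial inventories $x,y$, as described in the context. (a) If $\theta>0$, then $$\lim_{N\uparrow\infty}\mathbb{E}\big[\mathscr{C}_{\mathbb{T}_N}(\bm\xi^{(N)}|\bm\eta^{(N)})\big]=\frac{(x+y)^2\big(36e^{6\rho T}(8\rho T+13)-60e^{3\rho T}-3\big)}{16\big(2e^{3\rho T}(3\rho T+5)-1\big)^2}+\frac{x^2-y^2}{2(\rho T+1)}+\frac{(x-y)^2}{16(\rho T+1)^2}.$$ (b) If $\theta=0$, then $$\lim_{N\uparrow\infty}\mathbb{E}\big[\mathscr{C}_{\mathbb{T}_{2N}}(\bm\xi^{(2N)}|\bm\eta^{(2N)})\big]=\frac{(x+y)^2(6e^{6\rho T}+3)}{2\big(2e^{6\rho T}(3\rho T+5)+e^{3\rho T}+3\rho T+7\big)}+\frac{x^2-y^2}{2(e^{-\rho T}+\rho T+1)}$$ and $$\lim_{N\uparrow\infty}\mathbb{E}\big[\mathscr{C}_{\mathbb{T}_{2N+1}}(\bm\xi^{(2N+1)}|\bm\eta^{(2N+1)})\big]=\frac{(x+y)^2(6e^{6\rho T}-3)}{2\big(2e^{6\rho T}(3\rho T+5)-3e^{3\rho T}-3\rho T-7\big)}+\frac{x^2-y^2}{2(-e^{-\rho T}+\rho T+1)}.$$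
   Context: Model: Let $(\Omega,(\mathscr F_t)_{t\ge0},\mathscr F,\mathbb P)$ be a filtered probability space with right-continuous filtration and $\mathbb P$-trivial $\mathscr F_0$, and let $S^0$ be a right-continuous martingale (unaffected price). Fix $\rho>0$, $T>0$, $\theta\ge0$, and for $N\ge2$ the grid $\mathbb T_N=\{t_k=kT/N: k=0,\dots,N\}$. An admissible strategy for inventory $z$ is a vector $\bm\zeta=(\zeta_0,\dots,\zeta_N)$ of bounded random variables with $\zeta_k$ $\mathscr F_{t_k}$-measurable and $\sum_k\zeta_k=z$ a.s.; denote the set by $\mathscr X(z,\mathbb T_N)$. For $\bm\xi\in\mathscr X(x,\mathbb T_N)$, $\bm\eta\in\mathscr X(y,\mathbb T_N)$ the price is $S^{\bm\xi,\bm\eta}_t=S^0_t-\sum_{t_k<t}e^{-\rho(t-t_k)}(\xi_k+\eta_k)$. With $(\varepsilon_k)$ i.i.d. Bernoulli$(1/2)$ independent of $\sigma(\bigcup_t\mathscr F_t)$, the costs are $\mathscr C_{\mathbb T_N}(\bm\xi|\bm\eta)=xS^0_0+\sum_{k=0}^N\big(\tfrac12\xi_k^2-S^{\bm\xi,\bm\eta}_{t_k}\xi_k+\varepsilon_k\xi_k\eta_k+\theta\xi_k^2\big)$ and $\mathscr C_{\mathbb T_N}(\bm\eta|\bm\xi)=yS^0_0+\sum_{k=0}^N\big(\tfrac12\eta_k^2-S^{\bm\xi,\bm\eta}_{t_k}\eta_k+(1-\varepsilon_k)\xi_k\eta_k+\theta\eta_k^2\big)$. A Nash equilibrium is a pair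 $(\bm\xi^*,\bm\eta^* )\in\mathscr X(x,\mathbb T_N)\times\mathscr X(y,\mathbb T_N)$ such that $\bm\xi^*$ minimizes $\mathbb E[\mathscr C_{\mathbb T_N}(\cdot|\bm\eta^* )]$ over $\mathscr X(x,\mathbb T_N)$ and $\bm\eta^*$ minimizes $\mathbb E[\mathscr C_{\mathbb T_N}(\cdot|\bm\xi^* )]$ over $\mathscr X(y,\mathbb T_N)$. It is known that there is a unique Nash equilibrium, given by the deterministic vectors $\bm\xi^{(N)}=\frac12(x+y)\bm v+\frac12(x-y)\bm w$ and $\bm\eta^{(N)}=\frac12(x+y)\bm v-\frac12(x-y)\bm w$, where: $\tilde\Gamma$ is the $(N+1)\times(N+1)$ lower triangular matrix with $\tilde\Gamma_{ij}=0$ ($i<j$), $1/2$ ($i=j$), $e^{-\rho(i-j)T/N}$ ($i>j$); $\Gamma=\tilde\Gamma+\tilde\Gamma^\top$; $\bm\nu=(\Gamma+\tilde\Gamma+2\theta\mathrm{Id})^{-1}\mathbf1$, $\bm\omega=(\Gamma-\tilde\Gamma+2\theta\mathrm{Id})^{-1}\mathbf1$; $\bm v=\bm\nu/(\mathbf1^\top\bm\nu)$, $\bm w=\bm\omega/(\mathbf1^\top\bm\omega)$. *)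

(* Defs.v *)
From HB Require Import structures.
From mathcomp Require Import all_boot all_order all_algebra.
From mathcomp Require Import all_classical all_reals all_analysis.
Set Implicit Arguments. Unset Strict Implicit. Unset Printing Implicit Defensive.
Import Order.TTheory GRing.Theory Num.Theory.
Import numFieldNormedType.Exports.
Local Open Scope classical_set_scope.
Local Open Scope ring_scope.

Section Defs.
Context {R : realType}.

Section Prob.
Context {d : measure_display} {Omega : measurableType d}.

Definition filtration (F : R -> set (set Omega)) : Prop :=
  (forall t, 0 <= t -> sigma_algebra setT (F t) /\ F t `<=` measurable) /\
  (forall s t, 0 <= s -> s <= t -> F s `<=` F t).

Definition right_continuous_filtration (F : R -> set (set Omega)) : Prop :=
  forall t, 0 <= t -> F t = \bigcap_(s in `]t, +oo[%classic) F s.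

Definition trivial_at0 (P : probability Omega R) (F : R -> set (set Omega)) : Prop :=
  forall A, F 0 A -> (P A = 0)%E \/ (P A = 1)%E.

(* S is an (F_t)-martingale under P: adapted, integrable, and
   E[S_t | F_s] = S_s, i.e. \int_A S_t dP = \int_A S_s dP for all A in F_s. *)
Definition martingale (P : probability Omega R) (F : R -> set (set Omega))
    (S : R -> Omega -> R) : Prop :=
  (forall t, 0 <= t ->
     (forall B : set R, measurable B -> F t (S t @^-1` B)) /\
     P.-integrable setT (EFin \o S t)) /\
  (forall s t, 0 <= s -> s <= t -> forall A, F s A ->
     (\int[P]_(w in A) (S t w)%:E = \int[P]_(w in A) (S s w)%:E)%E).

Definition right_continuous_paths (S : R -> Omega -> R) : Prop :=
  forall w t, 0 <= t -> (fun s => S s w) @ t^'+ --> S t w.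

(* (eps_k)_k are i.i.d. Bernoulli(1/2) ({0,1}-valued) random variables,
   (jointly) independent of sigma(\bigcup_t F_t): for every event A of that
   sigma-algebra, every finite set K of indices and every b in {0,1}^K,
   P(A /\ eps_k = b_k for k in K) = P(A) * (1/2)^|K|. *)
Definition iid_bernoulli_half_indep (P : probability Omega R)
    (F : R -> set (set Omega)) (eps : nat -> Omega -> R) : Prop :=
  (forall k, measurable_fun setT (eps k)) /\
  (forall k w, eps k w = 0 \/ eps k w = 1) /\
  (forall (K : seq nat) (b : nat -> R) (A : set Omega), uniq K ->
     (forall k, b k = 0 \/ b k = 1) ->
     <<s \bigcup_(t in `[0, +oo[%classic) F t >> A ->
     P (A `&` \bigcap_(k in [set k | k \in K]) [set w | eps k w = b k]) =
       (P A * ((2^-1) ^+ size K)%:E)%E).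

End Prob.

Definition grid_time (T : R) (N k : nat) : R := k%:R * T / N%:R.

Definition Gtilde (rho T : R) (N : nat) : 'M[R]_N.+1 :=
  \matrix_(i, j) (if (i < j)%N then 0
                  else if i == j then 2^-1
                  else expR (- (rho * ((i - j)%:R * T / N%:R)))).

Definition Gamma (rho T : R) (N : nat) : 'M[R]_N.+1 :=
  Gtilde rho T N + (Gtilde rho T N)^T.

Definition nu_vec (rho T theta : R) (N : nat) : 'cV[R]_N.+1 :=
  invmx (Gamma rho T N + Gtilde rho T N + (2 * theta)%:M) *m const_mx 1.

Definition omega_vec (rho T theta : R) (N : nat) : 'cV[R]_N.+1 :=
  invmx (Gamma rho T N - Gtilde rho T N + (2 * theta)%:M) *m const_mx 1.

Definition v_vec (rho T theta : R) (N : nat) : 'cV[R]_N.+1 :=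
  (\sum_i nu_vec rho T theta N i 0)^-1 *: nu_vec rho T theta N.

Definition w_vec (rho T theta : R) (N : nat) : 'cV[R]_N.+1 :=
  (\sum_i omega_vec rho T theta N i 0)^-1 *: omega_vec rho T theta N.

Definition xi_eq (rho T theta x y : R) (N : nat) : 'cV[R]_N.+1 :=
  ((x + y) / 2) *: v_vec rho T theta N + ((x - y) / 2) *: w_vec rho T theta N.

Definition eta_eq (rho T theta x y : R) (N : nat) : 'cV[R]_N.+1 :=
  ((x + y) / 2) *: v_vec rho T theta N - ((x - y) / 2) *: w_vec rho T theta N.

Section Cost.
Context {Omega : Type}.

Definition price (rho T : R) (N : nat) (S0 : R -> Omega -> R)
    (xi eta : 'cV[R]_N.+1) (k : 'I_N.+1) (w : Omega) : R :=
  S0 (grid_time T N k) w -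
  \sum_(j < N.+1 | grid_time T N j < grid_time T N k)
     expR (- (rho * (grid_time T N k - grid_time T N j))) * (xi j 0 + eta j 0).

Definition cost (rho T theta x : R) (N : nat) (S0 : R -> Omega -> R)
    (eps : nat -> Omega -> R) (xi eta : 'cV[R]_N.+1) (w : Omega) : R :=
  x * S0 0 w +
  \sum_(k < N.+1)
    (2^-1 * xi k 0 ^+ 2 - price rho T S0 xi eta k w * xi k 0
     + eps k w * xi k 0 * eta k 0 + theta * xi k 0 ^+ 2).

End Cost.

Definition expected_eq_cost {d : measure_display} {Omega : measurableType d}
    (P : probability Omega R) (rho T theta x y : R) (S0 : R -> Omega -> R)
    (eps : nat -> Omega -> R) (N : nat) : \bar R :=
  (\int[P]_w (cost rho T theta x S0 eps
                 (xi_eq rho T theta x y N) (eta_eq rho T theta x y N) w)%:E)%E.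

End Defs.

(* Main.v *)
Require Import Defs.
From HB Require Import structures.
From mathcomp Require Import all_boot all_order all_algebra.
From mathcomp Require Import ring lra zify.
From mathcomp Require Import all_classical all_reals all_analysis.
Import Order.TTheory GRing.Theory Num.Theory.
Import numFieldNormedType.Exports.
Local Open Scope classical_set_scope.
Local Open Scope ring_scope.
Set Implicit Arguments. Unset Strict Implicit. Unset Printing Implicit Defensive.

(** The martingale and Bernoulli terms average out, so the expected cost is the
    quadratic form xi^T Gt (xi + eta) + theta xi^T xi.  Pairing the equations
    (Gamma + Gt + 2 theta) nu = 1 and (Gamma - Gt + 2 theta) omega = 1 with nu and
    omega expresses it through V = 1^T nu, W = 1^T omega and theta times |nu|^2,
    nu.omega, |omega|^2.

    The exponential kernel makes both systems explicitly solvable.  Write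
    a = e^(-rho T/N), delta = 1 - a and kap = 1/2 + 2 theta.  Then
    omega_k = A' + B' r^(N-k) with r = a (kap - 1)/kap, and
    nu_k = A + B m1^k + C m2^k, where m1, m2 are the roots of the quadratic
    [char] in [nu_closed_form]; here m1 = 1 + 3 delta + o(delta), whence
    m1^N -> E = e^(3 rho T), while m1 m2 = (kap - 1)/kap.  The coefficients A, B are
    of order delta; C and B' have nonzero limits and carry the boundary layers.
    For theta > 0 the limit (kap - 1)/kap of m2 and r has modulus < 1, so m2^N and
    r^N vanish, the layers sit at opposite ends (nu.omega -> 0) and
    only they contribute to |nu|^2 and |omega|^2.  For theta = 0 that limit is -1,
    m2 = -1/m1 and r = -a, so m2^(N+1) and r^(N+1) have limits depending
    on the parity of N. *)

(** * The kernel matrix *)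

(** The entries of [Gtilde] as a function of [nat] indices and of the ratio [a], so that rows can be
    split, shifted and reversed without ordinal casts. *)
Definition kern {K : fieldType} (a : K) (i j : nat) : K :=
  if (i < j)%N then 0 else if i == j then 2^-1 else a ^+ (i - j).

Definition decay {R : realType} (rho T : R) (N : nat) : R :=
  expR (- (rho * T / N%:R)).

Lemma GtildeE (R : realType) (rho T : R) (N : nat) (i j : 'I_N.+1) :
  Gtilde rho T N i j = kern (decay rho T N) i j.
Proof.
rewrite mxE /kern; case: ltnP => // _; case: eqP => [->|ne]; first by rewrite eqxx.
have -> : (i == j :> nat) = false by apply/eqP => e; apply/ne/val_inj.
rewrite /decay -expRM_natl; congr expR; ring.
Qed.

Lemma sum_kern (K : fieldType) (a : K) (n i : nat) (u : nat -> K) : (i < n)%N ->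
  \sum_(j < n) kern a i j * u j = u i / 2 + \sum_(j < i) a ^+ (i - j) * u j.
Proof.
move=> lin; rewrite -(big_mkord xpredT (fun j => kern a i j * u j)).
rewrite (big_cat_nat _ (n := i)) //= 1?ltnW // addrC; congr (_ + _).
  rewrite big_ltn // big_nat big1 ?addr0; first by rewrite /kern ltnn eqxx mulrC.
  by move=> j /andP[ij _]; rewrite /kern ij mul0r.
rewrite big_mkord; apply: eq_bigr => j _.
by rewrite /kern ltnNge (ltnW (ltn_ord j)) /= gtn_eqF.
Qed.

Lemma sum_kern_tr (K : fieldType) (a : K) (n i : nat) (u : nat -> K) : (i <= n)%N ->
  \sum_(j < n.+1) kern a j i * u j
    = u i / 2 + \sum_(j < n - i) a ^+ j.+1 * u (i + j).+1.
Proof.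
move=> lin; rewrite -(big_mkord xpredT (fun j => kern a j i * u j)).
rewrite (big_cat_nat _ (n := i)) //= 1?ltnW // big_nat big1 ?add0r; last first.
  by move=> j /andP[_ ij]; rewrite /kern ij mul0r.
rewrite big_ltn // {1}/kern ltnn eqxx mulrC; congr (_ + _).
rewrite -{1}[i.+1]add0n big_addn subSS big_mkord; apply: eq_bigr => j _.
have -> : (j + i.+1 = (i + j).+1)%N by lia.
rewrite /kern ltnNge ltnW ?ltnS ?leq_addr //= gtn_eqF ?ltnS ?leq_addr //.
by have -> : ((i + j).+1 - i = j.+1)%N by lia.
Qed.

(** The sum is the cofactor of [a - m] in the factorisation of [a ^+ i - m ^+ i]; in this multiplied
    form the case [a = m] is included. *)
Lemma low_geometric (K : fieldType) (a m : K) (i : nat) :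
  (a - m) * \sum_(j < i) a ^+ (i - j) * m ^+ j = a * (a ^+ i - m ^+ i).
Proof.
rewrite subrXX mulrCA; congr (_ * _); rewrite big_distrr /=; apply: eq_bigr => j _.
rewrite mulrA -exprS; congr (a ^+ _ * _); have := ltn_ord j; lia.
Qed.

Lemma sum_expr (K : fieldType) (q : K) (n : nat) :
  q != 1 -> \sum_(k < n) q ^+ k = (q ^+ n - 1) / (q - 1).
Proof. by move=> q1; rewrite subrX1 mulrC mulKf ?subr_eq0. Qed.

(** Geometric sequences are eigenvectors of the kernel up to one boundary term, a multiple of
    [a ^+ i]. For the transpose the boundary term decays from the other end. *)
Lemma kern_geometric (K : fieldType) (a m : K) (n i : nat) : (i < n)%N -> a != m ->
  \sum_(j < n) kern a i j * m ^+ j = m ^+ i / 2 + a * (a ^+ i - m ^+ i) / (a - m).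
Proof.
move=> lin am; rewrite (@sum_kern _ a n i (fun j => m ^+ j) lin); congr (_ + _).
by rewrite -low_geometric mulrAC mulfV ?mul1r ?subr_eq0.
Qed.

Lemma kern_tr_geometric (K : fieldType) (a m : K) (n i : nat) : (i <= n)%N ->
  a * m != 1 ->
  \sum_(j < n.+1) kern a j i * m ^+ j
    = m ^+ i / 2 + (a * m ^+ i.+1 - a ^+ (n - i).+1 * m ^+ n.+1) / (1 - a * m).
Proof.
move=> lin am; rewrite (@sum_kern_tr _ a n i (fun j => m ^+ j) lin); congr (_ + _).
transitivity (a * m ^+ i.+1 * \sum_(j < n - i) (a * m) ^+ j).
  rewrite big_distrr; apply: eq_bigr => j _ /=.
  by rewrite exprMn !exprS exprD; ring.
rewrite sum_expr // exprMn !exprS.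
have -> : m ^+ n = m ^+ i * m ^+ (n - i) by rewrite -exprD subnKC.
by field; rewrite !subr_eq0 ?[_ == a * m]eq_sym am.
Qed.

(* With q_(k+1) = a q_k + u_k the form is (q_n^2 + (1 - a^2) sum_k q_k^2) / 2. *)
Lemma kern_definite (R : realFieldType) (a : R) (n : nat) (u : nat -> R) :
  a ^+ 2 < 1 ->
  0 <= \sum_(i < n) \sum_(j < n) kern a i j * u i * u j /\
  (\sum_(i < n) \sum_(j < n) kern a i j * u i * u j = 0 ->
   forall i, (i < n)%N -> u i = 0).
Proof.
move=> a1; pose q := fix q k := if k is k'.+1 then a * q k' + u k' else 0.
have qE i : \sum_(j < i) a ^+ (i - j) * u j = a * q i.
  elim: i => [|i IH]; first by rewrite big_ord0 mulr0.
  rewrite big_ord_recr /= subSnn expr1 mulrDr; congr (_ + _).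
  rewrite -IH big_distrr /=; apply: eq_bigr => j _.
  by rewrite mulrA -exprS subSn // ltnW.
have SE : \sum_(i < n) \sum_(j < n) kern a i j * u i * u j
    = (q n ^+ 2 + (1 - a ^+ 2) * \sum_(k < n) q k ^+ 2) / 2.
  transitivity (\sum_(i < n) u i * (u i / 2 + a * q i)).
    apply: eq_bigr => i _; rewrite -qE -(@sum_kern _ a n i u (ltn_ord i)) big_distrr /=.
    by apply: eq_bigr => j _; rewrite mulrAC mulrC.
  elim: n => [|n IH]; first by rewrite !big_ord0 /=; ring.
  by rewrite !big_ord_recr IH /=; field.
have Q0 : 0 <= \sum_(k < n) q k ^+ 2 by apply: sumr_ge0 => k _; apply: sqr_ge0.
have c0 : 0 < 1 - a ^+ 2 by rewrite subr_gt0.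
rewrite SE; split=> [|H i lin].
  by rewrite divr_ge0 // addr_ge0 ?sqr_ge0 // mulr_ge0 // ltW.
(* A vanishing sum of nonnegative squares forces [q k = 0] for all [k <= n], and then
   [u i = q i.+1 - a * q i = 0]. *)
have /eqP : q n ^+ 2 + (1 - a ^+ 2) * \sum_(k < n) q k ^+ 2 = 0 by lra.
rewrite paddr_eq0 ?sqr_ge0 ?mulr_ge0 ?(ltW c0) // sqrf_eq0 mulf_eq0 (gt_eqF c0) /=.
rewrite psumr_eq0 => [/andP[/eqP qn /allP qk]|k _]; last exact: sqr_ge0.
have qz k : (k <= n)%N -> q k = 0.
  rewrite leq_eqVlt => /orP[/eqP -> //|kn]; apply/eqP; rewrite -sqrf_eq0.
  exact: (qk (Ordinal kn) (mem_index_enum _)).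
by have := qz i.+1 lin; rewrite /= (qz i (ltnW lin)) mulr0 add0r.
Qed.

(** Every row [u] of the left kernel has [u *m M = 0], so the form vanishes at [u] and [u] is zero.
    This covers the nonsymmetric matrices below. *)
Lemma definite_unitmx (K : fieldType) (n : nat) (M : 'M[K]_n) :
  (forall u : 'rV_n, (u *m M *m u^T) 0 0 = 0 -> u = 0) -> M \in unitmx.
Proof.
move=> H; rewrite -row_free_unit -kermx_eq0; apply/eqP/row_matrixP => i.
by rewrite row0; apply: H; rewrite -row_mul mulmx_ker row0 mul0mx mxE.
Qed.

(** * Closed forms of the two equilibrium vectors *)

Ltac nonzero :=
  repeat (apply/andP; split); try done;
  first [by rewrite subr_eq0 | by rewrite subr_eq0 eq_sym].

(** The nu-operator multiplies [m ^+ i] by a scalar whose numerator is the characteristic quadratic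
    in [m], up to boundary terms in [a ^+ i.+1] and [a ^+ (n - i).+1]. *)
Lemma kern_mode (K : numFieldType) (a m kap theta : K) (n i : nat) :
  (i <= n)%N -> a != m -> a * m != 1 -> kap = 2^-1 + 2 * theta ->
  \sum_(j < n.+1) (2 * kern a i j + kern a j i) * m ^+ j + 2 * theta * m ^+ i
  = (a * kap * m ^+ 2 - ((kap + 1) * (1 + a ^+ 2) - 3 * a ^+ 2) * m + a * (kap - 1))
      / ((a - m) * (1 - a * m)) * m ^+ i
    + 2 * a ^+ i.+1 / (a - m) - a ^+ (n - i).+1 * m ^+ n.+1 / (1 - a * m).
Proof.
move=> lin am am1 kE.
have -> : \sum_(j < n.+1) (2 * kern a i j + kern a j i) * m ^+ j
    = 2 * \sum_(j < n.+1) kern a i j * m ^+ j + \sum_(j < n.+1) kern a j i * m ^+ j.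
  by rewrite big_distrr -big_split; apply: eq_bigr => j _ /=; ring.
rewrite kern_geometric // kern_tr_geometric // kE !exprS.
field; nonzero.
Qed.

(** Superposition of the modes 1, [m1] and [m2]. The roots of [char] leave only boundary terms, the
    equation for [A] makes the constant mode produce the right-hand side 1, and the last two
    hypotheses cancel the coefficients of [a ^+ i.+1] and [a ^+ (n - i).+1]. *)
Lemma nu_closed_form (K : numFieldType) (a m1 m2 A B C kap theta : K) (n i : nat) :
  let nu k := A + B * m1 ^+ k + C * m2 ^+ k in
  let char m :=
    a * kap * m ^+ 2 - ((kap + 1) * (1 + a ^+ 2) - 3 * a ^+ 2) * m + a * (kap - 1) in
  (i <= n)%N -> kap = 2^-1 + 2 * theta ->
  a != 1 -> a != m1 -> a != m2 -> a * m1 != 1 -> a * m2 != 1 ->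
  char m1 = 0 -> char m2 = 0 ->
  A * ((kap + 1) * (1 - a) + 3 * a) = 1 - a ->
  B / (a - m1) + C / (a - m2) = A / (1 - a) ->
  B * m1 ^+ n.+1 / (1 - a * m1) + C * m2 ^+ n.+1 / (1 - a * m2) = - (A / (1 - a)) ->
  \sum_(j < n.+1) (2 * kern a i j + kern a j i) * nu j + 2 * theta * nu i = 1.
Proof.
move=> nu char lin kE a1 am1 am2 am1' am2' c1 c2 HA H1 H2.
have mode m := @kern_mode K a m kap theta n i lin.
have a1' : a * 1 != 1 by rewrite mulr1.
pose S m := \sum_(j < n.+1) (2 * kern a i j + kern a j i) * m ^+ j + 2 * theta * m ^+ i.
transitivity (A * S 1 + B * S m1 + C * S m2).
  have -> : \sum_(j < n.+1) (2 * kern a i j + kern a j i) * nu j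
    = A * \sum_(j < n.+1) (2 * kern a i j + kern a j i) * 1 ^+ j
      + B * \sum_(j < n.+1) (2 * kern a i j + kern a j i) * m1 ^+ j
      + C * \sum_(j < n.+1) (2 * kern a i j + kern a j i) * m2 ^+ j.
    rewrite !big_distrr -!big_split; apply: eq_bigr => j _ /=.
    by rewrite /nu expr1n; ring.
  by rewrite /S /nu expr1n; ring.
rewrite /S !mode // -/(char m1) -/(char m2) c1 c2 !expr1n !mul0r !add0r.
(* The first summand comes from [char 1 = - (1 - a) * ((kap + 1) * (1 - a) + 3 * a)]. *)
transitivity (A * ((kap + 1) * (1 - a) + 3 * a) / (1 - a)
    + 2 * a ^+ i.+1 * (B / (a - m1) + C / (a - m2) - A / (1 - a))
    - a ^+ (n - i).+1 * (B * m1 ^+ n.+1 / (1 - a * m1) + C * m2 ^+ n.+1 / (1 - a * m2)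
       + A / (1 - a))); last first.
  by rewrite HA H1 H2 subrr addNr !mulr0 addr0 subr0 divff // subr_eq0 eq_sym.
have na : 1 - a != 0 by rewrite subr_eq0 eq_sym.
field.
nonzero.
Qed.

(* The omega-system is upper triangular; reversing the indices turns it into a
   lower triangular one. *)
Lemma kern_rev (K : fieldType) (a : K) (n i j : nat) : (i <= n)%N -> (j <= n)%N ->
  kern a (n - j) i = kern a (n - i) j.
Proof.
move=> lin ljn; rewrite /kern.
have -> : (n - j < i)%N = (n - i < j)%N by lia.
have -> : (n - j == i)%N = (n - i == j)%N by lia.
by have -> : (n - j - i = n - i - j)%N by lia.
Qed.

(** After the reversal a single boundary term, in [a ^+ (n - i)], remains. The choice of [r] gives
    [a - r = a / kap], so the factor [kap - a / (a - r)] of the geometric mode vanishes; the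
    condition on [B] cancels its boundary term against that of the constant mode. *)
Lemma omega_closed_form (K : numFieldType) (a r A B kap theta : K) (n i : nat) :
  let om k := A + B * r ^+ (n - k) in
  (i <= n)%N -> kap = 2^-1 + 2 * theta -> kap != 0 -> a != 0 -> a != 1 ->
  r = a * (kap - 1) / kap ->
  A * (kap * (1 - a) + a) = 1 - a -> B * (1 - a) * kap = A * a ->
  \sum_(j < n.+1) kern a j i * om j + 2 * theta * om i = 1.
Proof.
move=> om lin kE k0 a0 a1 rE HA HB.
have ar : a - r = a / kap by rewrite rE; field.
have nar : a != r by rewrite -subr_eq0 ar mulf_neq0 ?invr_eq0.
have na : 1 - a != 0 by rewrite subr_eq0 eq_sym.
have na' : a - 1 != 0 by rewrite subr_eq0.
set p := (n - i)%N.
have -> : \sum_(j < n.+1) kern a j i * om j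
    = \sum_(j < n.+1) kern a p j * (A + B * r ^+ j).
  rewrite (reindex_inj rev_ord_inj) /=; apply: eq_bigr => j _.
  have jn : (j <= n)%N by rewrite -ltnS.
  by rewrite subSS kern_rev // /om subKn.
have -> : om i = A + B * r ^+ p by [].
have -> : \sum_(j < n.+1) kern a p j * (A + B * r ^+ j)
    = A * \sum_(j < n.+1) kern a p j * 1 ^+ j + B * \sum_(j < n.+1) kern a p j * r ^+ j.
  by rewrite !big_distrr -big_split; apply: eq_bigr => j _ /=; rewrite expr1n; ring.
rewrite !kern_geometric ?ltnS ?leq_subr // expr1n ar.
have BE : B = A * a / ((1 - a) * kap).
  by rewrite -HB; field; nonzero.
transitivity (A * (kap * (1 - a) + a) / (1 - a)); last by rewrite HA divff.
have -> : theta = (kap - 2^-1) / 2 by rewrite kE; field.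
by rewrite BE; field; nonzero.
Qed.

(** * Invertibility and the quadratic form of the cost *)

Lemma Gtilde_form_ge0 (R : realType) (rho T : R) (N : nat) (u : 'rV[R]_N.+1) :
  0 < rho * T / N%:R ->
  0 <= (u *m Gtilde rho T N *m u^T) 0 0 /\
  ((u *m Gtilde rho T N *m u^T) 0 0 = 0 -> u = 0).
Proof.
move=> h0; set a := decay rho T N.
have a1 : a ^+ 2 < 1.
  have al : a < 1 by rewrite /a /decay expR_lt1 oppr_lt0.
  by rewrite expr2 mulr_ilt1 ?expR_ge0.
(* [inord] extends the entries to all of [nat]; its default value for [k > N] never enters the
   sums. *)
pose f k := u 0 (inord k).
have fE (i : 'I_N.+1) : f i = u 0 i by rewrite /f inord_val.
have -> : (u *m Gtilde rho T N *m u^T) 0 0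
    = \sum_(i < N.+1) \sum_(j < N.+1) kern a i j * f i * f j.
  rewrite -mulmxA mxE; apply: eq_bigr => i _; rewrite mxE big_distrr /=.
  by apply: eq_bigr => j _; rewrite !mxE -GtildeE mxE !fE; ring.
have [ge0 eq0] := @kern_definite R a N.+1 f a1; split=> // /eq0 H.
by apply/rowP => i; rewrite mxE -fE H.
Qed.

Lemma form_tr (R : comNzRingType) (n : nat) (M : 'M[R]_n) (u : 'rV_n) :
  (u *m M^T *m u^T) 0 0 = (u *m M *m u^T) 0 0.
Proof.
have -> : u *m M^T *m u^T = (u *m M *m u^T)^T by rewrite !trmx_mul trmxK mulmxA.
by rewrite [LHS]mxE.
Qed.

Lemma form_sqr_ge0 (R : realFieldType) (n : nat) (u : 'rV[R]_n) :
  0 <= (u *m u^T) 0 0.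
Proof. by rewrite mxE sumr_ge0 // => i _; rewrite mxE -expr2 sqr_ge0. Qed.

(** A quadratic form does not distinguish a matrix from its transpose, so the form here is three
    times that of [Gtilde] plus [2 * theta] times the squared norm. *)
Lemma nu_unitmx (R : realType) (rho T theta : R) (N : nat) :
  0 < rho * T / N%:R -> 0 <= theta ->
  Gamma rho T N + Gtilde rho T N + (2 * theta)%:M \in unitmx.
Proof.
move=> h0 th0; apply: definite_unitmx => u H.
have [ge0 eq0] := Gtilde_form_ge0 u h0; apply: eq0.
have s0 : 0 <= theta * (u *m u^T) 0 0 by rewrite mulr_ge0 ?form_sqr_ge0.
move: H; rewrite /Gamma !mulmxDr !mulmxDl mul_mx_scalar -scalemxAl.
by rewrite 3!mxE [X in _ + X = _]mxE form_tr; lra.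
Qed.

Lemma omega_unitmx (R : realType) (rho T theta : R) (N : nat) :
  0 < rho * T / N%:R -> 0 <= theta ->
  Gamma rho T N - Gtilde rho T N + (2 * theta)%:M \in unitmx.
Proof.
move=> h0 th0; apply: definite_unitmx => u H.
have [ge0 eq0] := Gtilde_form_ge0 u h0; apply: eq0.
have s0 : 0 <= theta * (u *m u^T) 0 0 by rewrite mulr_ge0 ?form_sqr_ge0.
move: H; rewrite /Gamma [_ + _ - _]addrAC subrr add0r mulmxDr mulmxDl mul_mx_scalar -scalemxAl.
by rewrite mxE [X in _ + X = _]mxE form_tr; lra.
Qed.

Lemma nu_mulE (R : realType) (rho T theta : R) (N : nat) (u : 'cV[R]_N.+1) i :
  ((Gamma rho T N + Gtilde rho T N + (2 * theta)%:M) *m u) i 0 =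
  \sum_(j < N.+1) (2 * kern (decay rho T N) i j + kern (decay rho T N) j i) * u j 0
    + 2 * theta * u i 0.
Proof.
rewrite mulmxDl mul_scalar_mx mxE [X in _ + X = _]mxE; congr (_ + _).
rewrite mxE; apply: eq_bigr => j _; rewrite -!GtildeE 3!mxE; congr (_ * _).
by rewrite [_^T _ _]mxE; ring.
Qed.

Lemma omega_mulE (R : realType) (rho T theta : R) (N : nat) (u : 'cV[R]_N.+1) i :
  ((Gamma rho T N - Gtilde rho T N + (2 * theta)%:M) *m u) i 0 =
  \sum_(j < N.+1) kern (decay rho T N) j i * u j 0 + 2 * theta * u i 0.
Proof.
rewrite mulmxDl mul_scalar_mx mxE [X in _ + X = _]mxE; congr (_ + _).
rewrite /Gamma [_ + _ - _]addrAC subrr add0r mxE; apply: eq_bigr => j _.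
by rewrite -!GtildeE mxE.
Qed.

Lemma nu_eqn (R : realType) (rho T theta : R) (N : nat) (i : 'I_N.+1) :
  0 < rho * T / N%:R -> 0 <= theta ->
  \sum_(j < N.+1) (2 * kern (decay rho T N) i j + kern (decay rho T N) j i)
      * nu_vec rho T theta N j 0 + 2 * theta * nu_vec rho T theta N i 0 = 1.
Proof.
by move=> h0 th0; rewrite -nu_mulE /nu_vec mulKVmx ?nu_unitmx // mxE.
Qed.

Lemma omega_eqn (R : realType) (rho T theta : R) (N : nat) (i : 'I_N.+1) :
  0 < rho * T / N%:R -> 0 <= theta ->
  \sum_(j < N.+1) kern (decay rho T N) j i
      * omega_vec rho T theta N j 0 + 2 * theta * omega_vec rho T theta N i 0 = 1.
Proof.
by move=> h0 th0; rewrite -omega_mulE /omega_vec mulKVmx ?omega_unitmx // mxE.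
Qed.

Lemma nu_unique (R : realType) (rho T theta : R) (N : nat) (f : nat -> R) :
  0 < rho * T / N%:R -> 0 <= theta ->
  (forall i, (i <= N)%N ->
   \sum_(j < N.+1) (2 * kern (decay rho T N) i j + kern (decay rho T N) j i) * f j
     + 2 * theta * f i = 1) ->
  forall i : 'I_N.+1, nu_vec rho T theta N i 0 = f i.
Proof.
move=> h0 th0 H i.
suff -> : nu_vec rho T theta N = \col_j f j by rewrite mxE.
apply: (canLR (mulKmx (nu_unitmx h0 th0))); apply/colP => k.
rewrite nu_mulE [LHS]mxE -[LHS](H k (ltn_ord k)) [X in _ = _ + _ * X]mxE; congr (_ + _).
by apply: eq_bigr => j _; rewrite mxE.
Qed.

Lemma omega_unique (R : realType) (rho T theta : R) (N : nat) (f : nat -> R) :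
  0 < rho * T / N%:R -> 0 <= theta ->
  (forall i, (i <= N)%N ->
   \sum_(j < N.+1) kern (decay rho T N) j i * f j + 2 * theta * f i = 1) ->
  forall i : 'I_N.+1, omega_vec rho T theta N i 0 = f i.
Proof.
move=> h0 th0 H i.
suff -> : omega_vec rho T theta N = \col_j f j by rewrite mxE.
apply: (canLR (mulKmx (omega_unitmx h0 th0))); apply/colP => k.
rewrite omega_mulE [LHS]mxE -[LHS](H k (ltn_ord k)) [X in _ = _ + _ * X]mxE; congr (_ + _).
by apply: eq_bigr => j _; rewrite mxE.
Qed.

(** Since [xi i + eta i = 2 * p * nu i], the kernel is applied to [nu] only. The cost thus involves
    just the forms [f nu nu] and [f om nu], and the two linear systems evaluate both. *)
Lemma equilibrium_cost (R : realFieldType) (n : nat) (k : 'I_n -> 'I_n -> R)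
    (nu om : 'I_n -> R) (theta p q : R) :
  (forall i, \sum_j (2 * k i j + k j i) * nu j + 2 * theta * nu i = 1) ->
  (forall i, \sum_j k j i * om j + 2 * theta * om i = 1) ->
  let V := \sum_i nu i in let X := \sum_i nu i * om i in
  let Qn := \sum_i nu i ^+ 2 in let Qo := \sum_i om i ^+ 2 in
  let xi i := p * nu i + q * om i in
  let eta i := p * nu i - q * om i in
  \sum_i (xi i * \sum_j k i j * (xi j + eta j) + theta * xi i ^+ 2)
    = 2 / 3 * p ^+ 2 * V + 2 * p * q * V
      - theta * (p ^+ 2 * Qn / 3 + 2 * p * q * X - q ^+ 2 * Qo).
Proof.
move=> Hnu Hom V X Qn Qo xi eta.
pose f (u v : 'I_n -> R) := \sum_i \sum_j k i j * u i * v j.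
(* The nu-system paired with [nu]: two kernels and one transpose all give the same form. *)
have fnn : 3 * f nu nu + 2 * theta * Qn = V.
  have -> : V = \sum_i nu i * (\sum_j (2 * k i j + k j i) * nu j + 2 * theta * nu i).
    by apply: eq_bigr => i _; rewrite Hnu mulr1.
  have -> : 3 * f nu nu = \sum_i nu i * (\sum_j (2 * k i j + k j i) * nu j).
    transitivity (2 * f nu nu + \sum_i \sum_j k j i * nu i * nu j).
      rewrite exchange_big /=.
      have -> : \sum_j \sum_i k j i * nu i * nu j = f nu nu.
        by apply: eq_bigr => i _; apply: eq_bigr => j _; ring.
      ring.
    rewrite /f big_distrr -big_split; apply: eq_bigr => i _ /=.
    rewrite !big_distrr -big_split; apply: eq_bigr => j _ /=; ring.
  rewrite /Qn big_distrr -big_split; apply: eq_bigr => i _ /=; ring.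
(* The omega-system paired with [nu]. *)
have fon : f om nu + 2 * theta * X = V.
  rewrite /f exchange_big /X big_distrr -big_split; apply: eq_bigr => i _ /=.
  rewrite -[RHS]mulr1 -[X in _ = _ * X](Hom i) mulrDr big_distrr /=; congr (_ + _); last by ring.
  by apply: eq_bigr => j _; ring.
transitivity (2 * p * (p * f nu nu + q * f om nu)
    + theta * (p ^+ 2 * Qn + 2 * p * q * X + q ^+ 2 * Qo)); last first.
  have -> : f nu nu = (V - 2 * theta * Qn) / 3 by rewrite -fnn; field.
  have -> : f om nu = V - 2 * theta * X by rewrite -fon; ring.
  by field.
rewrite big_split /=; congr (_ + _).
  rewrite /f !big_distrr -big_split big_distrr; apply: eq_bigr => i _ /=.
  rewrite !big_distrr -big_split big_distrr; apply: eq_bigr => j _ /=.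
  by rewrite /xi /eta; ring.
rewrite -big_distrr /=; congr (_ * _).
rewrite /Qn /X /Qo !big_distrr -!big_split; apply: eq_bigr => i _ /=.
by rewrite /xi; ring.
Qed.

(** * Limits of powers and geometric sums *)

Section PointwiseLimits.
Context {R : realType} {I : Type} {F : set_system I} {FF : Filter F}.
Implicit Types (f g : I -> R) (a b : R).

(** These limit rules are stated for functions in applied form, so that [lim_step] can match an
    expression subterm by subterm. *)
Lemma limD f g a b : f x @[x --> F] --> a -> g x @[x --> F] --> b ->
  (f x + g x) @[x --> F] --> a + b.
Proof. exact: cvgD. Qed.

Lemma limN f a : f x @[x --> F] --> a -> (- f x) @[x --> F] --> - a.
Proof. exact: cvgN. Qed.

Lemma limM f g a b : f x @[x --> F] --> a -> g x @[x --> F] --> b ->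
  (f x * g x) @[x --> F] --> a * b.
Proof. exact: cvgM. Qed.

Lemma limV f a : f x @[x --> F] --> a -> a != 0 -> (f x)^-1 @[x --> F] --> a^-1.
Proof. by move=> fa a0; apply: cvgV. Qed.

Lemma limX f a n : f x @[x --> F] --> a -> (f x ^+ n) @[x --> F] --> a ^+ n.
Proof.
move=> fa; elim: n => [|n IH]; first exact: cvg_cst.
under eq_fun do rewrite exprS; rewrite exprS; exact: limM.
Qed.

Lemma lim_eq f a b : f x @[x --> F] --> a -> a = b -> f x @[x --> F] --> b.
Proof. by move=> fa <-. Qed.

Lemma lim_near f g a : (\forall x \near F, f x = g x) -> g x @[x --> F] --> a ->
  f x @[x --> F] --> a.
Proof. move=> fg ga; apply: cvg_trans ga; apply: near_eq_cvg.
by apply: filterS fg => x ->. Qed.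

Lemma lim_pos f a : f x @[x --> F] --> a -> 0 < a -> \forall x \near F, 0 < f x.
Proof. by move=> fa a0; apply: (cvgr_gt a fa). Qed.

Lemma lim_neq0 f a : f x @[x --> F] --> a -> a != 0 -> \forall x \near F, f x != 0.
Proof. by move=> fa a0; apply: (cvgr_neq0 a fa). Qed.

Lemma lim_expR f a : f x @[x --> F] --> a -> expR (f x) @[x --> F] --> expR a.
Proof. by move=> fa; apply: (continuous_cvg _ (@continuous_expR R a)). Qed.

Lemma lim_sqrt f a : f x @[x --> F] --> a -> Num.sqrt (f x) @[x --> F] --> Num.sqrt a.
Proof. by move=> fa; apply: (continuous_cvg _ (@sqrt_continuous R a)). Qed.

End PointwiseLimits.

(* Limits of subexpressions are looked up in the context (also among section
   facts that are never named) by syntactic comparison of the functions: testing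
   convertibility would unfold the local definitions and is very slow. *)
Ltac lim_hyp :=
  cbv beta;
  lazymatch goal with |- cvg_to (nbhs (@fmap _ _ ?f _)) _ =>
    match goal with H : cvg_to (nbhs (@fmap _ _ ?g _)) _ |- _ =>
      constr_eq f g; exact: H end
  end.

Ltac lim_step := first
  [ lim_hyp
  | apply: cvg_cst
  | apply: limD; [lim_step | lim_step]
  | apply: limN; lim_step
  | apply: limM; [lim_step | lim_step]
  | apply: limV; [lim_step | ]
  | apply: limX; lim_step
  | eassumption ].

Ltac lim := apply: lim_eq; [lim_step | ].

Section PowerLimits.
Context {R : realType} {F : set_system nat} {FF : ProperFilter F} (HF : F `=>` \oo).

(** [F] stands for infinity itself or for infinity along the even or the odd indices, which
    [theta = 0] treats separately; limits at infinity restrict to it. *)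
Lemma lim_sub (f : nat -> R) (a : R) : f n @[n --> \oo] --> a -> f n @[n --> F] --> a.
Proof. by move=> fa; apply: cvg_trans fa => A HA; apply: HF. Qed.

Lemma lim_invn : (n%:R : R)^-1 @[n --> F] --> 0.
Proof. apply: lim_sub; rewrite -(cvg_shiftS (fun n => (n%:R : R)^-1)).
exact: cvg_harmonic. Qed.

Lemma near_gt0 : \forall n \near F, (0 < n)%N.
Proof. by apply: HF; near=> n; near: n; exists 1%N. Unshelve. all: by end_near. Qed.

(** Applying 1 + t <= e^t to [mu n] and to [- mu n / (1 + mu n)] squeezes the power between two
    exponentials whose exponents both tend to [c]. *)
Lemma lim_compound (mu : nat -> R) (c : R) :
  mu n @[n --> F] --> 0 -> (n.+1%:R * mu n) @[n --> F] --> c ->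
  (1 + mu n) ^+ n.+1 @[n --> F] --> expR c.
Proof.
move=> mu0 muc.
have mu1 : (1 + mu n) @[n --> F] --> (1 : R) by lim; rewrite addr0.
have low : n.+1%:R * mu n * (1 + mu n)^-1 @[n --> F] --> c.
  by lim; rewrite ?invr1 ?mulr1 ?oner_neq0.
have e1 : expR (n.+1%:R * mu n) @[n --> F] --> expR c.
  exact: lim_expR.
have e2 : expR (n.+1%:R * mu n * (1 + mu n)^-1) @[n --> F] --> expR c.
  exact: lim_expR.
apply: (squeeze_cvgr _ e2 e1).
near=> n; have p : 0 < 1 + mu n by near: n; exact: lim_pos mu1 ltr01.
have le2 : 1 + mu n <= expR (mu n) by exact: expR_ge1Dx.
have le1 : expR (mu n * (1 + mu n)^-1) <= 1 + mu n.
  rewrite -[leRHS]invrK -[leLHS]invrK lef_pV2 ?posrE ?invr_gt0 ?expR_gt0 //.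
  rewrite -expRN; have := expR_ge1Dx (- (mu n * (1 + mu n)^-1)).
  apply: le_trans.
  rewrite le_eqVlt; apply/orP; left; apply/eqP; field; exact: lt0r_neq0.
rewrite -mulrA !expRM_natl; apply/andP; split; apply: lerXn2r => //;
  rewrite ?nnegrE ?expR_ge0 ?(ltW p) //.
Unshelve. all: by end_near. Qed.

Lemma bernoulli_ineq (h : R) n : 0 <= h -> 1 + n%:R * h <= (1 + h) ^+ n.
Proof.
move=> h0; elim: n => [|n IH]; first by rewrite mul0r addr0 expr0.
rewrite exprS; have := ler_wpM2l (addr_ge0 ler01 h0) IH; apply: le_trans.
rewrite -natr1 -subr_ge0.
have -> : (1 + h) * (1 + n%:R * h) - (1 + (n%:R + 1) * h) = n%:R * h ^+ 2 by ring.
by rewrite mulr_ge0 ?sqr_ge0.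
Qed.

(** With [t] the square root of [q], one has n q^n = (n t^n) t^n, and Bernoulli's inequality bounds
    n t^n by [(t^-1 - 1)^-1]. *)
Lemma lim_nX_cst (q : R) : 0 < q < 1 -> n%:R * q ^+ n @[n --> F] --> 0.
Proof.
move=> /andP[q0 q1]; pose t := Num.sqrt q.
have t0 : 0 < t by rewrite sqrtr_gt0.
have t2 : t ^+ 2 = q by rewrite sqr_sqrtr // ltW.
have t1 : t < 1 by rewrite -(@ltr_pXn2r _ 2) ?nnegrE ?(ltW t0) // t2 expr1n.
have h0 : 0 < t^-1 - 1 by rewrite subr_gt0 invf_gt1.
have tn : t ^+ n @[n --> F] --> 0.
  by apply: lim_sub; apply: cvg_expr; rewrite gtr0_norm.
have up : (t^-1 - 1)^-1 * t ^+ n @[n --> F] --> 0 by lim; rewrite mulr0.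
apply: (squeeze_cvgr _ (cvg_cst (0 : R)) up); near=> n.
rewrite mulr_ge0 ?exprn_ge0 ?(ltW q0) //= -t2 -exprM mul2n -addnn exprD mulrA.
rewrite ler_pM2r ?exprn_gt0 // -ler_pdivlMr ?exprn_gt0 // -exprVn.
rewrite -ler_pdivrMl ?invr_gt0 // invrK mulrC.
have := bernoulli_ineq n (ltW h0); rewrite addrCA subrr addr0; lra.
Unshelve. all: by end_near. Qed.

Lemma lim_nX (u : nat -> R) (l : R) : `|l| < 1 -> u n @[n --> F] --> l ->
  n%:R * u n ^+ n @[n --> F] --> 0.
Proof.
(* The midpoint [q] of |l| and 1 eventually dominates |u n|, which reduces the claim to a constant
   base. *)
move=> l1 ul; pose q := (1 + `|l|) / 2.
have l0 := normr_ge0 l.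
have q01 : 0 < q < 1 by rewrite /q; apply/andP; split; lra.
have lq : `|l| < q by rewrite /q; lra.
apply: norm_cvg0; apply: (squeeze_cvgr _ (cvg_cst (0 : R)) (lim_nX_cst q01)).
near=> n; have nq : `|u n| < q by near: n; exact: cvgr_lt `|l| (cvg_norm ul) q lq.
rewrite normr_ge0 normrM normrX ger0_norm //= ler_wpM2l // lerXn2r ?nnegrE //.
  by case/andP: q01 => /ltW.
exact: ltW.
Unshelve. all: by end_near. Qed.

Lemma lim_geo_far (q : nat -> R) (l L : R) : l != 1 ->
  q n @[n --> F] --> l -> q n ^+ n.+1 @[n --> F] --> L ->
  \sum_(k < n.+1) q n ^+ k @[n --> F] --> (L - 1) / (l - 1).
Proof.
move=> l1 ql qL; have lm : q n - 1 @[n --> F] --> l - 1 by lim.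
apply: (@lim_near _ _ _ _ _ (fun n => (q n ^+ n.+1 - 1) / (q n - 1))).
  rewrite -subr_eq0 in l1; apply: filterS (lim_neq0 lm l1) => n.
  by rewrite subr_eq0 => qn1; rewrite sum_expr.
by lim; rewrite ?subr_eq0.
Qed.

(** A ratio equal to [1 + c * delta n] to first order makes the sum grow like the inverse of
    [delta n]; the weight [delta n] brings the slow mode to a finite limit. *)
Lemma lim_geo_near (q delta : nat -> R) (c L : R) : c != 0 ->
  (q n - 1) / delta n @[n --> F] --> c -> q n ^+ n.+1 @[n --> F] --> L ->
  delta n * \sum_(k < n.+1) q n ^+ k @[n --> F] --> (L - 1) / c.
Proof.
move=> c0 qc qL.
apply: (@lim_near _ _ _ _ _ (fun n => (q n ^+ n.+1 - 1) / ((q n - 1) / delta n))).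
  apply: filterS (lim_neq0 qc c0) => n qn.
  (* Division by 0 gives 0, so a nonzero quotient has nonzero numerator and denominator. *)
  have d0 : delta n != 0 by apply: contra qn => /eqP ->; rewrite invr0 mulr0.
  have q1 : q n - 1 != 0 by apply: contra qn => /eqP ->; rewrite mul0r.
  rewrite sum_expr -1?subr_eq0 //; field; nonzero.
by lim.
Qed.

End PowerLimits.

(** * The characteristic roots as the grid is refined *)

Section DecayLimits.
Context {R : realType} {F : set_system nat} {FF : ProperFilter F} (HF : F `=>` \oo).
Context (rho T : R) (rho0 : 0 < rho) (T0 : 0 < T).

Lemma step_gt0 n : (0 < n)%N -> 0 < rho * T / n%:R.
Proof. by move=> n0; rewrite divr_gt0 ?mulr_gt0 ?ltr0n. Qed.

Lemma decay_lt1 n : (0 < n)%N -> decay rho T n < 1.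
Proof. by move=> n0; rewrite /decay expR_lt1 oppr_lt0 step_gt0. Qed.

(** With h = rho T / n, these are the bounds 1 - h <= e^(-h) <= 1 / (1 + h) rearranged and
    multiplied by n. *)
Lemma decay_bounds n : (0 < n)%N ->
  rho * T * (1 + rho * T / n%:R)^-1 <= n%:R * (1 - decay rho T n) <= rho * T.
Proof.
move=> n0; have h0 := step_gt0 n0; have np : 0 < n%:R :> R by rewrite ltr0n.
set h := rho * T / n%:R in h0 *; have sE : rho * T = n%:R * h.
  by rewrite /h; field; exact: lt0r_neq0.
have h1 : 0 < 1 + h by lra.
rewrite sE -mulrA !ler_pM2l //; apply/andP; split; last first.
  by have := expR_ge1Dx (- h); rewrite /decay -/h; lra.
have le : decay rho T n <= (1 + h)^-1.
  rewrite /decay -/h expRN lef_pV2 ?posrE ?expR_gt0 //; exact: expR_ge1Dx.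
have -> : h * (1 + h)^-1 = 1 - (1 + h)^-1 by field; exact: lt0r_neq0.
lra.
Qed.

Lemma lim_decay_gap_n : n%:R * (1 - decay rho T n) @[n --> F] --> rho * T.
Proof.
have i0 := lim_invn (R := R) HF.
have low : rho * T * (1 + rho * T * (n%:R)^-1)^-1 @[n --> F] --> rho * T.
  by lim; rewrite mulr0 addr0 ?invr1 ?mulr1 ?oner_neq0.
apply: (squeeze_cvgr _ low (cvg_cst (rho * T))); near=> n.
by apply: decay_bounds; near: n; exact: near_gt0.
Unshelve. all: by end_near. Qed.

Lemma lim_decay_gap : (1 - decay rho T n) @[n --> F] --> (0 : R).
Proof.
have i0 := lim_invn (R := R) HF; have l := lim_decay_gap_n.
apply: (@lim_near _ _ _ _ _ (fun n => n%:R^-1 * (n%:R * (1 - decay rho T n)))).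
  apply: filterS (near_gt0 HF) => n n0; rewrite mulKf //.
  by rewrite pnatr_eq0 -lt0n.
by lim; rewrite mul0r.
Qed.

Lemma lim_decay : decay rho T n @[n --> F] --> (1 : R).
Proof.
have g := lim_decay_gap.
apply: (@lim_near _ _ _ _ _ (fun n => 1 - (1 - decay rho T n))).
  by apply: nearW => n; ring.
by lim; rewrite subr0.
Qed.

Lemma lim_decay_gap_nS : n.+1%:R * (1 - decay rho T n) @[n --> F] --> rho * T.
Proof.
have g := lim_decay_gap; have l := lim_decay_gap_n.
apply: (@lim_near _ _ _ _ _
  (fun n => n%:R * (1 - decay rho T n) + (1 - decay rho T n))).
  by apply: nearW => n; rewrite -natr1; ring.
by lim; rewrite addr0.
Qed.

Lemma lim_decayX : decay rho T n ^+ n.+1 @[n --> F] --> expR (- (rho * T)).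
Proof.
have g := lim_decay_gap; have l := lim_decay_gap_nS.
apply: (@lim_near _ _ _ _ _ (fun n => (1 + - (1 - decay rho T n)) ^+ n.+1)).
  by apply: nearW => n; congr (_ ^+ _); ring.
apply: lim_compound; first by lim; rewrite oppr0.
apply: (@lim_near _ _ _ _ _ (fun n => - (n.+1%:R * (1 - decay rho T n)))).
  by apply: nearW => n; ring.
by lim.
Qed.

End DecayLimits.

(** The quadratic formula: the discriminant tends to 1, so both roots are eventually real, and
    Vieta's formula gives their product. *)
Lemma char_roots (R : realType) (F : set_system nat) (FF : ProperFilter F)
    (a : nat -> R) (kap : R) : 0 < kap ->
  a n @[n --> F] --> (1 : R) -> (\forall n \near F, a n < 1) ->
  exists m1 m2 : nat -> R,
  [/\ (\forall n \near F, forall m, m = m1 n \/ m = m2 n ->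
        a n * kap * m ^+ 2 - ((kap + 1) * (1 + a n ^+ 2) - 3 * a n ^+ 2) * m
          + a n * (kap - 1) = 0),
      (\forall n \near F, m1 n * m2 n = (kap - 1) / kap),
      m1 n @[n --> F] --> (1 : R), m2 n @[n --> F] --> (kap - 1) / kap &
      (m1 n - 1) / (1 - a n) @[n --> F] --> (3 : R)].
Proof.
move=> k0 a1 alt; have kn0 := lt0r_neq0 k0.
pose P n := (kap + 1) * (1 + a n ^+ 2) - 3 * a n ^+ 2.
pose D n := P n ^+ 2 - 4 * a n ^+ 2 * (kap * (kap - 1)).
have Pl : P n @[n --> F] --> 2 * kap - 1 by rewrite /P; lim; ring.
have Dl : D n @[n --> F] --> (1 : R) by rewrite /D; lim; ring.
have Sl : Num.sqrt (D n) @[n --> F] --> (1 : R).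
  by rewrite -[X in _ --> X]sqrtr1; apply: lim_sqrt.
pose m1 n := (P n + Num.sqrt (D n)) * (2 * a n * kap)^-1.
pose m2 n := (P n - Num.sqrt (D n)) * (2 * a n * kap)^-1.
have den0 : 2 * 1 * kap != 0 by rewrite mulr1 mulf_neq0 // pnatr_eq0.
have m1l : m1 n @[n --> F] --> (1 : R) by rewrite /m1; lim => //; field.
have m2l : m2 n @[n --> F] --> (kap - 1) / kap by rewrite /m2; lim => //; field.
have an0 : \forall n \near F, a n != 0 by apply: lim_neq0 a1 (oner_neq0 _).
(* [Num.sqrt] squares back only for nonnegative arguments; [D n] is eventually positive. *)
have S2 : \forall n \near F, Num.sqrt (D n) ^+ 2 = D n.
  by apply: filterS (lim_pos Dl ltr01) => n /ltW; exact: sqr_sqrtr.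
have root : \forall n \near F, forall m, m = m1 n \/ m = m2 n ->
    a n * kap * m ^+ 2 - P n * m + a n * (kap - 1) = 0.
  near=> n; have a0 : a n != 0 by near: n.
  have s2 : Num.sqrt (D n) ^+ 2 = D n by near: n.
  (* Both signs of the square root at once: the value of the quadratic is a multiple of
     [t ^+ 2 - D n]. *)
  have key (t : R) : t ^+ 2 = D n -> a n * kap * ((P n + t) * (2 * a n * kap)^-1) ^+ 2
      - P n * ((P n + t) * (2 * a n * kap)^-1) + a n * (kap - 1) = 0.
    move=> t2; transitivity ((t ^+ 2 - D n) / (4 * a n * kap)).
      by rewrite /D; field; nonzero.
    by rewrite t2 subrr mul0r.
  by move=> m [->|->]; apply: key; rewrite ?sqrrN.
exists m1, m2; split => //.
  near=> n; have a0 : a n != 0 by near: n.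
  have s2 : Num.sqrt (D n) ^+ 2 = D n by near: n.
  transitivity ((P n ^+ 2 - Num.sqrt (D n) ^+ 2) / (4 * a n ^+ 2 * kap ^+ 2)).
    by rewrite /m1 /m2; field; nonzero.
  by rewrite s2 /D; field; nonzero.
(* Substituting m = 1 + mu in the characteristic equation gives
   mu (2 a kap - P + a kap mu) = (1 - a) (kap + 1 - (kap - 2) a). *)
pose den n := 2 * a n * kap - P n + a n * kap * (m1 n - 1).
have denl : den n @[n --> F] --> (1 : R) by rewrite /den; lim; ring.
apply: (@lim_near _ _ _ _ _ (fun n => (kap + 1 - (kap - 2) * a n) / den n)); last first.
  by lim; rewrite ?oner_neq0 // invr1; ring.
near=> n; have d0 : den n != 0 by near: n; apply: lim_neq0 denl (oner_neq0 _).
have a0 : 1 - a n != 0 by rewrite subr_eq0 gt_eqF //; near: n.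
apply/eqP; rewrite eqr_div //; apply/eqP.
have rt : forall m, m = m1 n \/ m = m2 n ->
    a n * kap * m ^+ 2 - P n * m + a n * (kap - 1) = 0 by near: n.
have r := rt _ (or_introl erefl).
apply/eqP; rewrite -subr_eq0; apply/eqP; rewrite -[RHS]r /den /P; ring.
Unshelve. all: by end_near. Qed.

(** * Limits of the sums over the equilibrium vectors *)

Section ModeSums.
Context {K : comNzRingType} (n : nat).
Implicit Types p q c x y : K.

Let sum_cst p : \sum_(i < n.+1) p = p * n.+1%:R.
Proof. by rewrite sumr_const card_ord mulr_natr. Qed.

Lemma sum_rev_expr x : \sum_(i < n.+1) x ^+ (n - i) = \sum_(i < n.+1) x ^+ i.
Proof.
rewrite (reindex_inj rev_ord_inj) /=; apply: eq_bigr => i _.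
by rewrite subSS subKn // -ltnS.
Qed.

(** Meant for the cross sum of nu and omega, where the omega ratio is [a] times the product of the
    two nu ratios. *)
Lemma sum_expr_rev a x y :
  \sum_(i < n.+1) x ^+ i * (a * x * y) ^+ (n - i)
    = x ^+ n * \sum_(i < n.+1) (a * y) ^+ i.
Proof.
rewrite -[in RHS]sum_rev_expr mulr_sumr; apply: eq_bigr => i _.
have -> : x ^+ n = x ^+ i * x ^+ (n - i) by rewrite -exprD subnKC // -ltnS.
by rewrite !exprMn; ring.
Qed.

Lemma sum_two_modes p q c x y :
  \sum_(i < n.+1) (p + q * x ^+ i + c * y ^+ i)
    = p * n.+1%:R + q * (\sum_(i < n.+1) x ^+ i) + c * \sum_(i < n.+1) y ^+ i.
Proof. by rewrite -sum_cst !mulr_sumr -!big_split. Qed.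

Lemma sum_two_modes_sqr p q c x y :
  \sum_(i < n.+1) (p + q * x ^+ i + c * y ^+ i) ^+ 2
    = p ^+ 2 * n.+1%:R + q ^+ 2 * (\sum_(i < n.+1) (x ^+ 2) ^+ i)
      + c ^+ 2 * (\sum_(i < n.+1) (y ^+ 2) ^+ i)
      + 2 * p * q * (\sum_(i < n.+1) x ^+ i) + 2 * p * c * (\sum_(i < n.+1) y ^+ i)
      + 2 * q * c * \sum_(i < n.+1) (x * y) ^+ i.
Proof.
rewrite -sum_cst !mulr_sumr -!big_split; apply: eq_bigr => i _ /=.
by rewrite ![(_ ^+ 2) ^+ i]exprAC exprMn; ring.
Qed.

End ModeSums.

Section EquilibriumLimits.
Context {R : realType} {F : set_system nat} {FF : ProperFilter F} (HF : F `=>` \oo).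
Context (rho T theta : R) (rho0 : 0 < rho) (T0 : 0 < T) (theta0 : 0 <= theta).

Let kap := 2^-1 + 2 * theta.
Let E := expR (3 * (rho * T)).
Let a := decay rho T.
Let delta n := 1 - a n.
(** [delta n * u n] is the coefficient [A] demanded by [nu_closed_form]. *)
Let u n := ((kap + 1) * delta n + 3 * a n)^-1.
Let r n := a n * (kap - 1) / kap.

Let kap_gt0 : 0 < kap. Proof. by rewrite ltr_pwDl ?invr_gt0 ?mulr_ge0. Qed.
Let kap_neq0 : kap != 0. Proof. exact: lt0r_neq0. Qed.
Let la : a n @[n --> F] --> (1 : R). Proof. exact: lim_decay. Qed.
Let ldelta : delta n @[n --> F] --> (0 : R). Proof. exact: lim_decay_gap. Qed.
Let ldeltaN : n.+1%:R * delta n @[n --> F] --> rho * T.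
Proof. exact: lim_decay_gap_nS. Qed.
Let near_lt1 : \forall n \near F, a n < 1.
Proof. by apply: filterS (near_gt0 HF) => n; exact: decay_lt1. Qed.
Let l_sub1 : (kap - 1) / kap - 1 = - kap^-1. Proof. by field. Qed.
Let l_neq1 : (kap - 1) / kap != 1.
Proof. by rewrite -subr_eq0 l_sub1 oppr_eq0 invr_eq0. Qed.
Let lr : r n @[n --> F] --> (kap - 1) / kap.
Proof. by rewrite /r; lim; rewrite mul1r. Qed.

(** The counterpart of [u] for [omega_closed_form]. *)
Let u' n := (kap * delta n + a n)^-1.
Let lu' : u' n @[n --> F] --> (1 : R).
Proof. by rewrite /u'; lim; rewrite mulr0 add0r ?invr1 ?oner_neq0. Qed.

Lemma omega_shape : \forall n \near F, forall i : 'I_n.+1,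
  omega_vec rho T theta n i 0 = delta n * u' n + a n * u' n / kap * r n ^+ (n - i).
Proof.
near=> n.
have n0 : (0 < n)%N by near: n; exact: near_gt0.
have a1 : a n < 1 by near: n.
have a0 : 0 < a n by exact: expR_gt0.
have d0 : 0 < kap * delta n + a n.
  by rewrite addr_gt0 ?mulr_gt0 // /delta subr_gt0.
apply: (@omega_unique R rho T theta n
  (fun i => delta n * u' n + a n * u' n / kap * r n ^+ (n - i))) => //.
  exact: step_gt0.
move=> i lin.
apply: (@omega_closed_form R (a n) (r n) (delta n * u' n) (a n * u' n / kap) kap) => //;
  rewrite ?(lt0r_neq0 a0) ?(lt_eqF a1) //.
  by rewrite -mulrA mulVf ?mulr1 // lt0r_neq0.
by rewrite /delta; field; nonzero.
Unshelve. all: by end_near. Qed.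

(** The constant mode contributes [rho * T], the boundary layer [1 - rl]. *)
Lemma lim_omega_sum (rl : R) : r n ^+ n.+1 @[n --> F] --> rl ->
  (\sum_(i < n.+1) omega_vec rho T theta n i 0) @[n --> F] --> rho * T + 1 - rl.
Proof.
move=> lrn.
have lg := @lim_geo_far R F FF _ _ _ l_neq1 lr lrn.
apply: (@lim_near _ _ _ _ _ (fun n => u' n * (n.+1%:R * delta n)
   + a n * u' n / kap * \sum_(k < n.+1) r n ^+ k)); last first.
  by lim => //; rewrite l_sub1; field.
apply: filterS omega_shape => n H.
under eq_bigr do rewrite H.
rewrite big_split /= sumr_const card_ord -mulr_natl -mulr_sumr sum_rev_expr.
by ring.
Qed.

(** [M] will be 0 for [theta > 0] and plus or minus [1 / E] for [theta = 0], so that one computation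
    serves both cases. The quantity [2 * E - M] is the limiting boundary determinant up to a
    positive factor. *)
Context (m1 m2 : nat -> R) (M : R).
Context (roots : \forall n \near F, forall m, m = m1 n \/ m = m2 n ->
  a n * kap * m ^+ 2 - ((kap + 1) * (1 + a n ^+ 2) - 3 * a n ^+ 2) * m
    + a n * (kap - 1) = 0).
Context (lm1 : m1 n @[n --> F] --> (1 : R)).
Context (lm2 : m2 n @[n --> F] --> (kap - 1) / kap).
Context (le : (m1 n - 1) / (1 - a n) @[n --> F] --> (3 : R)).
Context (lm2X : m2 n ^+ n.+1 @[n --> F] --> M).
Context (EM_neq0 : 2 * E - M != 0).

Let e n := (m1 n - 1) / delta n.
Let near_delta : \forall n \near F, delta n != 0.
Proof. by apply: filterS near_lt1 => n an; rewrite subr_eq0 gt_eqF. Qed.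
Let lee : e n @[n --> F] --> (3 : R). Proof. exact: le. Qed.

Lemma lim_slow_rootX : m1 n ^+ n.+1 @[n --> F] --> E.
Proof.
apply: (@lim_near _ _ _ _ _ (fun n => (1 + (m1 n - 1)) ^+ n.+1)).
  by apply: nearW => n; congr (_ ^+ _); ring.
apply: lim_compound; first by lim; rewrite subrr.
apply: (@lim_near _ _ _ _ _ (fun n => (n.+1%:R * delta n) * e n)); last first.
  by lim; ring.
by apply: filterS near_delta => n d0; rewrite /e; field.
Qed.
Let lm1X := lim_slow_rootX.

(** With [m1 n = 1 + delta n * e n], both [a n - m1 n] and [1 - a n * m1 n] are of order [delta n].
    [al1] and [be1] are their inverses multiplied by [delta n], so all four quantities have finite
    limits. *)
Let al1 n := (- (1 + e n))^-1.
Let be1 n := (1 - a n * e n)^-1.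
Let al2 n := (a n - m2 n)^-1.
Let be2 n := (1 - a n * m2 n)^-1.
(* [b] and [C] solve by Cramer's rule the two boundary conditions of
   [nu_closed_form], with B = delta b. *)
Let De n := al1 n * be2 n * m2 n ^+ n.+1 - al2 n * be1 n * m1 n ^+ n.+1.
Let b n := u n * (be2 n * m2 n ^+ n.+1 + al2 n) / De n.
Let C n := - u n * (al1 n + be1 n * m1 n ^+ n.+1) / De n.

Let one_sub_l : 1 - (kap - 1) / kap = kap^-1. Proof. by field. Qed.
Let lal1 : al1 n @[n --> F] --> (- 4^-1 : R).
Proof.
rewrite /al1; lim; first by rewrite oppr_eq0 -[1]/(1%:R) -natrD pnatr_eq0.
by rewrite invrN; congr (- _^-1); ring.
Qed.
Let lbe1 : be1 n @[n --> F] --> (- 2^-1 : R).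
Proof.
have e1 : 1 - 1 * 3 = - 2 :> R by ring.
by rewrite /be1; lim; rewrite e1 ?invrN // oppr_eq0 pnatr_eq0.
Qed.
Let lal2 : al2 n @[n --> F] --> kap.
Proof. by rewrite /al2; lim; rewrite one_sub_l ?invrK ?invr_eq0. Qed.
Let lbe2 : be2 n @[n --> F] --> kap.
Proof. by rewrite /be2; lim; rewrite mul1r one_sub_l ?invrK ?invr_eq0. Qed.
Let lDe : De n @[n --> F] --> kap * (2 * E - M) / 4.
Proof. by rewrite /De; lim; field. Qed.
Let lDe_neq0 : kap * (2 * E - M) / 4 != 0.
Proof. by rewrite !mulf_neq0 // invr_eq0 pnatr_eq0. Qed.
Let lu : u n @[n --> F] --> (3^-1 : R).
Proof. by rewrite /u; lim; rewrite mulr0 add0r mulr1 // pnatr_eq0. Qed.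
Let lb : b n @[n --> F] --> 4 * (1 + M) / (3 * (2 * E - M)).
Proof. by rewrite /b; lim => //; field; nonzero. Qed.
Let lC : C n @[n --> F] --> (2 * E + 1) / (3 * kap * (2 * E - M)).
Proof. by rewrite /C; lim => //; field; nonzero. Qed.

Lemma nu_shape : \forall n \near F, forall i : 'I_n.+1,
  nu_vec rho T theta n i 0
  = delta n * u n + delta n * b n * m1 n ^+ i + C n * m2 n ^+ i.
Proof.
near=> n.
have n0 : (0 < n)%N by near: n; exact: near_gt0.
have a1 : a n < 1 by near: n.
have a0 : 0 < a n by exact: expR_gt0.
have d0 : delta n != 0 by near: n.
have u0 : (kap + 1) * delta n + 3 * a n != 0.
  have dp : 0 < delta n by rewrite /delta subr_gt0.
  have k1 : 0 < kap + 1 by exact: addr_gt0.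
  by rewrite lt0r_neq0 // addr_gt0 // mulr_gt0.
have De0 : De n != 0 by near: n; apply: lim_neq0 lDe lDe_neq0.
have al10 : al1 n != 0.
  by near: n; apply: lim_neq0 lal1 _; rewrite oppr_eq0 invr_eq0 pnatr_eq0.
have be10 : be1 n != 0.
  by near: n; apply: lim_neq0 lbe1 _; rewrite oppr_eq0 invr_eq0 pnatr_eq0.
have al20 : al2 n != 0 by near: n; apply: lim_neq0 lal2 kap_neq0.
have be20 : be2 n != 0 by near: n; apply: lim_neq0 lbe2 kap_neq0.
have rt : forall m, m = m1 n \/ m = m2 n ->
  a n * kap * m ^+ 2 - ((kap + 1) * (1 + a n ^+ 2) - 3 * a n ^+ 2) * m
    + a n * (kap - 1) = 0 by near: n.
have m1E : m1 n = 1 + delta n * e n by rewrite /e; field.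
have am1 : a n - m1 n = delta n / al1 n.
  by rewrite /al1 invrK m1E /delta; ring.
have am1' : 1 - a n * m1 n = delta n / be1 n.
  by rewrite /be1 invrK m1E /delta; ring.
have am2 : a n - m2 n = (al2 n)^-1 by rewrite /al2 invrK.
have am2' : 1 - a n * m2 n = (be2 n)^-1 by rewrite /be2 invrK.
have h1 : a n - m1 n != 0 by rewrite am1 mulf_neq0 // invr_eq0.
have h2 : a n - m2 n != 0 by rewrite am2 invr_eq0.
have h3 : 1 - a n * m1 n != 0 by rewrite am1' mulf_neq0 // invr_eq0.
have h4 : 1 - a n * m2 n != 0 by rewrite am2' invr_eq0.
apply: (@nu_unique R rho T theta n
  (fun i => delta n * u n + delta n * b n * m1 n ^+ i + C n * m2 n ^+ i)) => //.
  exact: step_gt0.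
move=> i lin.
apply: (@nu_closed_form R (a n) (m1 n) (m2 n) (delta n * u n) (delta n * b n) (C n) kap) => //.
- by rewrite lt_eqF.
- by move: h1; rewrite subr_eq0.
- by move: h2; rewrite subr_eq0.
- by move: h3; rewrite subr_eq0 eq_sym.
- by move: h4; rewrite subr_eq0 eq_sym.
- by apply: rt; left.
- by apply: rt; right.
- by rewrite -mulrA mulVf ?mulr1.
(* All factors [delta n] cancel: the two boundary conditions become a linear system for [b n] and
   [C n] with right-hand sides [u n] and [- u n] and determinant [De n]. *)
- rewrite am1 am2 -/(delta n).
  transitivity (b n * al1 n + C n * al2 n); first by field; nonzero.
  transitivity (u n); last by field.
  transitivity (u n * (al1 n * be2 n * m2 n ^+ n.+1 - al2 n * be1 n * m1 n ^+ n.+1) / De n);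
    [by rewrite /b /C; ring | by rewrite -/(De n) mulfK].
- rewrite am1' am2' -/(delta n).
  transitivity (b n * be1 n * m1 n ^+ n.+1 + C n * be2 n * m2 n ^+ n.+1).
    by field; nonzero.
  transitivity (- u n); last by field.
  transitivity (- u n * (al1 n * be2 n * m2 n ^+ n.+1 - al2 n * be1 n * m1 n ^+ n.+1) / De n);
    [by rewrite /b /C; ring | by rewrite -/(De n) mulfK].
Unshelve. all: by end_near. Qed.

Let lg1 : delta n * (\sum_(k < n.+1) m1 n ^+ k) @[n --> F] --> (E - 1) / 3.
Proof. by apply: lim_geo_near lee lm1X; rewrite pnatr_eq0. Qed.
Let lg2 : (\sum_(k < n.+1) m2 n ^+ k) @[n --> F] --> (1 - M) * kap.
Proof.
apply: lim_eq; first exact: lim_geo_far l_neq1 lm2 lm2X.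
by rewrite l_sub1; field.
Qed.

(** The three summands come from the constant mode, the slow mode [m1] and the boundary layer
    [m2]. *)
Lemma lim_nu_sum : (\sum_(i < n.+1) nu_vec rho T theta n i 0) @[n --> F] -->
  rho * T / 3 + 4 * (1 + M) * (E - 1) / (9 * (2 * E - M))
    + (2 * E + 1) * (1 - M) / (3 * (2 * E - M)).
Proof.
apply: (@lim_near _ _ _ _ _ (fun n => u n * (n.+1%:R * delta n)
   + b n * (delta n * \sum_(k < n.+1) m1 n ^+ k)
   + C n * \sum_(k < n.+1) m2 n ^+ k)).
  apply: filterS nu_shape => n H; under eq_bigr do rewrite H.
  by rewrite sum_two_modes; ring.
by lim; field; nonzero.
Qed.

(** * Sums of squares and the cross sum when the boundary layers decay *)

Context (l_lt1 : `|(kap - 1) / kap| < 1).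
Context (roots_mul : \forall n \near F, m1 n * m2 n = (kap - 1) / kap).
Context (lm2n : n%:R * m2 n ^+ n @[n --> F] --> (0 : R)).
Context (lrX : r n ^+ n.+1 @[n --> F] --> (0 : R)) (M_eq0 : M = 0).

Let l2_neq1 : ((kap - 1) / kap) ^+ 2 != 1.
Proof.
have l2 : `|(kap - 1) / kap| ^+ 2 < 1 by rewrite expr2 mulr_ilt1.
by rewrite lt_eqF // (le_lt_trans _ l2) // -normrX ler_norm.
Qed.
Let l2_sub1 : ((kap - 1) / kap) ^+ 2 - 1 = - ((2 * kap - 1) / kap ^+ 2).
Proof. by field. Qed.
Let kap2_neq0 : 2 * kap - 1 != 0.
Proof.
apply: contra l2_neq1 => /eqP k; rewrite -subr_eq0 l2_sub1 k.
by rewrite mul0r oppr0.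
Qed.
Let lgr : (\sum_(k < n.+1) r n ^+ k) @[n --> F] --> kap.
Proof.
apply: lim_eq; first exact: lim_geo_far l_neq1 lr lrX.
by rewrite l_sub1; field.
Qed.
Let lgr2 : (\sum_(k < n.+1) (r n ^+ 2) ^+ k) @[n --> F] --> kap ^+ 2 / (2 * kap - 1).
Proof.
have q2 : (r n ^+ 2) ^+ n.+1 @[n --> F] --> (0 : R).
  by under eq_fun do rewrite exprAC; lim; rewrite mulr0.
apply: lim_eq; first by apply: lim_geo_far l2_neq1 _ q2; exact: limX.
by rewrite l2_sub1; field; nonzero.
Qed.
Let lg22 : (\sum_(k < n.+1) (m2 n ^+ 2) ^+ k) @[n --> F] --> kap ^+ 2 / (2 * kap - 1).
Proof.
have q2 : (m2 n ^+ 2) ^+ n.+1 @[n --> F] --> (0 : R).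
  by under eq_fun do rewrite exprAC; lim; rewrite M_eq0 mulr0.
apply: lim_eq; first by apply: lim_geo_far l2_neq1 _ q2; exact: limX.
by rewrite l2_sub1; field; nonzero.
Qed.
Let lg11 : delta n * (\sum_(k < n.+1) (m1 n ^+ 2) ^+ k) @[n --> F] --> (E ^+ 2 - 1) / 6.
Proof.
have q2 : (m1 n ^+ 2) ^+ n.+1 @[n --> F] --> E ^+ 2.
  by under eq_fun do rewrite exprAC; lim.
apply: lim_geo_near q2; first by rewrite pnatr_eq0.
apply: (@lim_near _ _ _ _ _ (fun n => e n * (m1 n + 1))).
  by apply: nearW => n; rewrite /e; ring.
by lim; ring.
Qed.
Let lg12 : (\sum_(k < n.+1) (m1 n * m2 n) ^+ k) @[n --> F] --> kap.
Proof.
have q2 : (m1 n * m2 n) ^+ n.+1 @[n --> F] --> (0 : R).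
  by under eq_fun do rewrite exprMn; lim; rewrite M_eq0 mulr0.
have q1 : m1 n * m2 n @[n --> F] --> (kap - 1) / kap by lim; rewrite mul1r.
apply: lim_eq; first exact: lim_geo_far l_neq1 q1 q2.
by rewrite l_sub1; field.
Qed.

(** Every product of modes other than the square of the layer keeps a factor [delta n] and
    disappears. *)
Lemma lim_nu_sqr : (\sum_(i < n.+1) nu_vec rho T theta n i 0 ^+ 2) @[n --> F] -->
  (2 * E + 1) ^+ 2 / (36 * E ^+ 2 * (2 * kap - 1)).
Proof.
have E0 : E != 0 by apply: lt0r_neq0; exact: expR_gt0.
apply: (@lim_near _ _ _ _ _ (fun n => delta n * u n ^+ 2 * (n.+1%:R * delta n)
   + delta n * b n ^+ 2 * (delta n * \sum_(k < n.+1) (m1 n ^+ 2) ^+ k)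
   + C n ^+ 2 * (\sum_(k < n.+1) (m2 n ^+ 2) ^+ k)
   + 2 * u n * b n * delta n * (delta n * \sum_(k < n.+1) m1 n ^+ k)
   + 2 * u n * C n * delta n * (\sum_(k < n.+1) m2 n ^+ k)
   + 2 * b n * C n * delta n * \sum_(k < n.+1) (m1 n * m2 n) ^+ k)).
  apply: filterS nu_shape => n H; under eq_bigr do rewrite H.
  by rewrite sum_two_modes_sqr; ring.
lim; rewrite M_eq0; field; nonzero.
Qed.

Lemma lim_omega_sqr : (\sum_(i < n.+1) omega_vec rho T theta n i 0 ^+ 2) @[n --> F] -->
  (2 * kap - 1)^-1.
Proof.
pose B n := a n * u' n / kap.
have lB : B n @[n --> F] --> kap^-1 by rewrite /B; lim; rewrite !mul1r.
apply: (@lim_near _ _ _ _ _ (fun n => delta n * u' n ^+ 2 * (n.+1%:R * delta n)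
   + B n ^+ 2 * (\sum_(k < n.+1) (r n ^+ 2) ^+ k)
   + 2 * u' n * B n * delta n * \sum_(k < n.+1) r n ^+ k)); last first.
  by lim; field; nonzero.
apply: filterS omega_shape => n H; under eq_bigr do rewrite H.
(* Omega has a single geometric mode; a second one with coefficient 0 lets the two-mode expansion
   apply. *)
transitivity (\sum_(i < n.+1) (delta n * u' n + B n * r n ^+ i + 0 * 0 ^+ i) ^+ 2).
  rewrite (reindex_inj rev_ord_inj) /=; apply: eq_bigr => i _.
  by rewrite subSS subKn -1?ltnS // mul0r addr0.
by rewrite sum_two_modes_sqr; ring.
Qed.

(** The layers live at opposite ends: by [r n = a n * m1 n * m2 n] their product sums to [m2 n ^+ n]
    times a geometric sum of order n, and [n%:R * m2 n ^+ n] tends to 0. The other products carry a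
    factor [delta n]. *)
Lemma lim_nu_omega :
  (\sum_(i < n.+1) nu_vec rho T theta n i 0 * omega_vec rho T theta n i 0)
    @[n --> F] --> (0 : R).
Proof.
pose B n := a n * u' n / kap.
have lB : B n @[n --> F] --> kap^-1 by rewrite /B; lim; rewrite !mul1r.
have lV := lim_nu_sum.
have lnd : n%:R * delta n @[n --> F] --> rho * T by exact: lim_decay_gap_n.
have rT0 : rho * T != 0 by rewrite mulf_neq0 // lt0r_neq0.
have lga2 : (\sum_(k < n.+1) (a n * m2 n) ^+ k) @[n --> F] --> kap.
  have q1 : a n * m2 n @[n --> F] --> (kap - 1) / kap by lim; rewrite mul1r.
  have aX : a n ^+ n.+1 @[n --> F] --> expR (- (rho * T)) by exact: lim_decayX.
  have q2 : (a n * m2 n) ^+ n.+1 @[n --> F] --> (0 : R).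
    by under eq_fun do rewrite exprMn; lim; rewrite M_eq0 mulr0.
  apply: lim_eq; first exact: lim_geo_far l_neq1 q1 q2.
  by rewrite l_sub1; field.
(* The value of [c] is immaterial, since it gets multiplied by a null sequence. *)
have [c lga1] : exists c : R,
    delta n * (\sum_(k < n.+1) (a n * m1 n) ^+ k) @[n --> F] --> c.
  have aX : a n ^+ n.+1 @[n --> F] --> expR (- (rho * T)) by exact: lim_decayX.
  have q2 : (a n * m1 n) ^+ n.+1 @[n --> F] --> expR (- (rho * T)) * E.
    by under eq_fun do rewrite exprMn; lim.
  have q1 : (a n * m1 n - 1) / delta n @[n --> F] --> (2 : R).
    apply: (@lim_near _ _ _ _ _ (fun n => a n * e n - 1)).
      apply: filterS near_delta => n d0.
      have -> : a n = 1 - delta n by rewrite /delta; ring.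
      by rewrite /e; field.
    by lim; ring.
  by eexists; apply: lim_geo_near q1 q2; rewrite pnatr_eq0.
apply: (@lim_near _ _ _ _ _ (fun n =>
   delta n * u' n * (\sum_(i < n.+1) nu_vec rho T theta n i 0)
   + B n * (delta n * u n * (\sum_(k < n.+1) r n ^+ k)
     + delta n * b n * (m1 n ^+ n.+1 * (m1 n)^-1) * (\sum_(k < n.+1) (a n * m2 n) ^+ k)
     + C n * ((n%:R * m2 n ^+ n) * (delta n * \sum_(k < n.+1) (a n * m1 n) ^+ k)
         * (n%:R * delta n)^-1)))); last first.
  by lim; rewrite ?oner_neq0 //; ring.
near=> n.
have n0 : n%:R != 0 :> R by rewrite pnatr_eq0 -lt0n; near: n; exact: near_gt0.
have d0 : delta n != 0 by near: n.
have m10 : m1 n != 0 by near: n; apply: lim_neq0 lm1 (oner_neq0 _).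
have Hn : forall i : 'I_n.+1, nu_vec rho T theta n i 0
  = delta n * u n + delta n * b n * m1 n ^+ i + C n * m2 n ^+ i.
  by near: n; exact: nu_shape.
have Ho : forall i : 'I_n.+1, omega_vec rho T theta n i 0
  = delta n * u' n + B n * r n ^+ (n - i) by near: n; exact: omega_shape.
have rE : r n = a n * m1 n * m2 n.
  have mm : m1 n * m2 n = (kap - 1) / kap by near: n.
  by rewrite -mulrA mm /r mulrA.
have rE' : r n = a n * m2 n * m1 n by rewrite rE mulrAC.
have -> : C n * ((n%:R * m2 n ^+ n) * (delta n * \sum_(k < n.+1) (a n * m1 n) ^+ k)
         * (n%:R * delta n)^-1) = C n * (m2 n ^+ n * \sum_(k < n.+1) (a n * m1 n) ^+ k).
  by field; nonzero.
have -> : m1 n ^+ n.+1 * (m1 n)^-1 = m1 n ^+ n by rewrite exprSr mulfK.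
rewrite -mulrA -[_ * m1 n ^+ n * _]mulrA -!sum_expr_rev -rE -rE' -(sum_rev_expr n (r n)).
rewrite !mulr_sumr -!big_split mulr_sumr -big_split; apply: eq_bigr => i _ /=.
by rewrite Ho Hn; ring.
Unshelve. all: by end_near. Qed.

End EquilibriumLimits.

(** * Expectation of the cost *)

(** Integrability is bundled with the value because additivity of the integral requires it at every
    step. *)
Definition has_mean {R : realType} {d : measure_display} {Omega : measurableType d}
    (P : probability Omega R) (f : Omega -> R) (m : R) : Prop :=
  P.-integrable setT (EFin \o f) /\ (\int[P]_w (f w)%:E = m%:E)%E.

Section Mean.
Context {R : realType} {d : measure_display} {Omega : measurableType d}.
Context (P : probability Omega R).
Implicit Types (f g : Omega -> R) (m c : R).

Lemma has_mean_cst c : has_mean P (cst c) c.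
Proof.
split; first exact: finite_measure_integrable_cst.
by rewrite /= integral_cst //= probability_setT mule1.
Qed.

Lemma has_meanD f g m c : has_mean P f m -> has_mean P g c ->
  has_mean P (fun w => f w + g w) (m + c).
Proof.
move=> [fi fE] [gi gE]; split; first exact: (integrableD measurableT fi gi).
by rewrite EFinD -fE -gE -integralD.
Qed.

Lemma has_meanZ f m c : has_mean P f m -> has_mean P (fun w => c * f w) (c * m).
Proof.
move=> [fi fE]; split; first exact: (integrableZl measurableT c fi).
by rewrite EFinM -fE -integralZl.
Qed.

Lemma has_mean_sum (n : nat) (f : 'I_n -> Omega -> R) (m : 'I_n -> R) :
  (forall k, has_mean P (f k) (m k)) ->
  has_mean P (fun w => \sum_(k < n) f k w) (\sum_(k < n) m k).
Proof.
elim: n f m => [|n IH] f m H.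
  by under eq_fun do rewrite big_ord0; rewrite big_ord0; apply: has_mean_cst.
under eq_fun do rewrite big_ord_recr /=; rewrite big_ord_recr /=.
by apply: has_meanD => //; apply: IH.
Qed.

(** The martingale identity between times 0 and [t] is taken on the whole space, which lies in [F 0]
    as the complement of the empty set. *)
Lemma has_mean_martingale (F : R -> set (set Omega)) (S : R -> Omega -> R) :
  filtration F -> martingale P F S ->
  exists m, forall t, 0 <= t -> has_mean P (S t) m.
Proof.
move=> [Fs _] [Si Se].
have S0i := (Si 0 (lexx 0)).2.
exists (fine (\int[P]_w (S 0 w)%:E)%E) => t t0; split; first exact: (Si t t0).2.
rewrite (Se 0 t (lexx _) t0) ?fineK //.
  exact: (integrable_fin_num measurableT S0i).
have [[F0 FC _] _] := Fs 0 (lexx 0).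
by rewrite -(setD0 setT); apply: FC.
Qed.

(** [eps k] is the indicator of the event [eps k = 1]; its probability is the product formula for
    one index and the whole space. *)
Lemma has_mean_bernoulli (F : R -> set (set Omega)) (eps : nat -> Omega -> R) k :
  filtration F -> iid_bernoulli_half_indep P F eps -> has_mean P (eps k) 2^-1.
Proof.
move=> [Fs _] [me [e01 eP]]; set A := [set w | eps k w = 1].
have mA : measurable A.
  rewrite -[A]setTI; have -> : A = eps k @^-1` [set 1] by [].
  exact: (me k measurableT _ (measurable_set1 1)).
have eA : eps k = \1_A.
  apply/funext => w; rewrite indicE; case: (e01 k w) => e; rewrite e.
    by rewrite memNset //= /A /= e => /eqP; rewrite eq_sym oner_eq0.
  by rewrite mem_set.
have PA : (P A = (2^-1)%:E)%E.
  have := eP [:: k] (fun=> 1) setT isT (fun=> or_intror erefl).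
  rewrite setTI expr1 probability_setT mul1e => <-.
    by congr (P _); rewrite [X in \bigcap_(_ in X) _](_ : _ = [set k]) ?bigcap_set1 //;
      apply/seteqP; split => j /=; rewrite inE => /eqP.
  move=> B [[B0 BC _] BF]; rewrite -(setD0 setT); exact: BC.
rewrite eA; split; last by rewrite integral_indic // setIT.
exact: integrable_indic.
Qed.

End Mean.

Lemma grid_time_lt (R : realType) (T : R) (N j k : nat) : 0 < T -> (0 < N)%N ->
  (grid_time T N j < grid_time T N k) = (j < k)%N.
Proof.
move=> T0 N0; rewrite /grid_time ltr_pM2r ?invr_gt0 ?ltr0n // ltr_pM2r //.
by rewrite ltr_nat.
Qed.

(** The martingale has constant mean and the trades sum to [x], so the price terms cancel
    [x * S0 0]. Half of the squared own trade and the mean 1/2 of [eps k] combine into the diagonal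
    entry 1/2 of the kernel. *)
Lemma expected_cost (R : realType) (d : measure_display) (Omega : measurableType d)
    (P : probability Omega R) (F : R -> set (set Omega)) (S0 : R -> Omega -> R)
    (eps : nat -> Omega -> R) (rho T theta x : R) (N : nat) (xi eta : 'cV[R]_N.+1) :
  0 < T -> (0 < N)%N -> filtration F -> martingale P F S0 ->
  iid_bernoulli_half_indep P F eps -> \sum_k xi k 0 = x ->
  (\int[P]_w (cost rho T theta x S0 eps xi eta w)%:E =
   (\sum_(k < N.+1) (xi k 0 * \sum_(j < N.+1) kern (decay rho T N) k j * (xi j 0 + eta j 0)
            + theta * xi k 0 ^+ 2))%:E)%E.
Proof.
move=> T0 N0 HF HS Heps Hx; have [m Sm] := has_mean_martingale HF HS.
set a := decay rho T N.
pose low (k : 'I_N.+1) := \sum_(j < N.+1 | (j < k)%N) a ^+ (k - j) * (xi j 0 + eta j 0).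
pose c (k : 'I_N.+1) := 2^-1 * xi k 0 ^+ 2 + low k * xi k 0 + theta * xi k 0 ^+ 2.
pose t (k : nat) := grid_time T N k.
have t0 k : 0 <= t k by rewrite /t /grid_time divr_ge0 ?mulr_ge0 ?ler0n ?ltW.
have costE : cost rho T theta x S0 eps xi eta = fun w => x * S0 0 w +
    \sum_(k < N.+1) (- xi k 0 * S0 (t k) w + (xi k 0 * eta k 0 * eps k w + cst (c k) w)).
  apply/funext => w; rewrite /cost; congr (_ + _); apply: eq_bigr => k _.
  rewrite /price /c /=.
  have -> : \sum_(j : 'I_N.+1 | grid_time T N j < grid_time T N k)
     expR (- (rho * (grid_time T N k - grid_time T N j))) * (xi j 0 + eta j 0) = low k.
    apply: eq_big => [j|j]; rewrite grid_time_lt //.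
    move=> jk; congr (_ * _).
    rewrite /a /decay -expRM_natl natrB 1?ltnW // /grid_time; congr expR; ring.
  by rewrite /t; ring.
have : has_mean P (cost rho T theta x S0 eps xi eta) (x * m +
    \sum_(k < N.+1) (- xi k 0 * m + (xi k 0 * eta k 0 * 2^-1 + c k))).
  rewrite costE; apply: has_meanD; first by apply: has_meanZ; apply: Sm.
  apply: has_mean_sum => k; apply: has_meanD; first by apply: has_meanZ; apply: Sm.
  apply: has_meanD; last exact: has_mean_cst.
  by apply: has_meanZ; apply: has_mean_bernoulli HF Heps.
case=> _ ->; congr EFin; rewrite big_split /= -big_distrl /= sumrN Hx.
rewrite mulNr addrA addrN add0r; apply: eq_bigr => k _.
have -> : \sum_(j < N.+1) kern a k j * (xi j 0 + eta j 0)
    = (xi k 0 + eta k 0) / 2 + low k.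
  rewrite (bigID (fun j : 'I__ => (j < k)%N)) /= addrC; congr (_ + _).
    rewrite (bigD1 k) ?ltnn //= big1 ?addr0 => [|j /andP[jk ne]].
      by rewrite /kern ltnn eqxx mulrC.
    rewrite /kern ltn_neqAle leqNgt jk andbT.
    by rewrite eq_sym (inj_eq val_inj) ne mul0r.
  apply: eq_bigr => j jk; rewrite /kern ltnNge (ltnW jk) /=.
  by rewrite gtn_eqF.
by rewrite /c; field.
Qed.

(** * Convergence of the equilibrium costs *)

Lemma equilibrium_expected_cost (R : realType) (d : measure_display)
    (Omega : measurableType d) (P : probability Omega R) (F : R -> set (set Omega))
    (S0 : R -> Omega -> R) (eps : nat -> Omega -> R) (rho T theta x y : R) (N : nat) :
  0 < rho -> 0 < T -> 0 <= theta -> (0 < N)%N ->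
  filtration F -> martingale P F S0 -> iid_bernoulli_half_indep P F eps ->
  let nu := nu_vec rho T theta N in let om := omega_vec rho T theta N in
  let V := \sum_(i < N.+1) nu i 0 in let W := \sum_(i < N.+1) om i 0 in
  let p := (x + y) / 2 / V in let q := (x - y) / 2 / W in
  V != 0 -> W != 0 ->
  expected_eq_cost P rho T theta x y S0 eps N =
   (2 / 3 * p ^+ 2 * V + 2 * p * q * V
     - theta * (p ^+ 2 * (\sum_(i < N.+1) nu i 0 ^+ 2) / 3
       + 2 * p * q * (\sum_(i < N.+1) nu i 0 * om i 0)
       - q ^+ 2 * \sum_(i < N.+1) om i 0 ^+ 2))%:E.
Proof.
move=> rho0 T0 th0 N0 HF HS Heps nu om V W p q V0 W0.
have h0 : 0 < rho * T / N%:R by exact: step_gt0.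
have xiE i : xi_eq rho T theta x y N i 0 = p * nu i 0 + q * om i 0.
  by rewrite !mxE -/nu -/om -/V -/W /p /q; ring.
have etaE i : eta_eq rho T theta x y N i 0 = p * nu i 0 - q * om i 0.
  by rewrite !mxE -/nu -/om -/V -/W /p /q; ring.
(* The inventory constraint reads p V + q W = x. *)
rewrite /expected_eq_cost (expected_cost (x := x) rho theta _ T0 N0 HF HS Heps); last first.
  under eq_bigr do rewrite xiE; rewrite big_split -!mulr_sumr /= -/V -/W.
  by rewrite /p /q; field; nonzero.
rewrite -(@equilibrium_cost R N.+1 (fun i j => kern (decay rho T N) i j)
  (fun i => nu i 0) (fun i => om i 0) theta p q).
- congr EFin; apply: eq_bigr => i _; rewrite xiE; congr (_ * _ + _).
  by apply: eq_bigr => j _; rewrite xiE etaE.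
- by move=> i; apply: nu_eqn.
- by move=> i; apply: omega_eqn.
Qed.

Lemma cvg_EFin_eq (R : realType) (I : Type) (F : set_system I) (f : I -> \bar R) (a b : R) :
  f n @[n --> F] --> a%:E -> a = b -> f n @[n --> F] --> b%:E.
Proof. by move=> fa <-. Qed.

Section CostLimit.
Context {R : realType} {F : set_system nat} {FF : ProperFilter F} (HF : F `=>` \oo).
Context (d : measure_display) (Omega : measurableType d) (P : probability Omega R).
Context (G : R -> set (set Omega)) (S0 : R -> Omega -> R) (eps : nat -> Omega -> R).
Context (rho T theta x y : R).
Context (rho0 : 0 < rho) (T0 : 0 < T) (theta0 : 0 <= theta).
Context (HG : filtration G) (HS : martingale P G S0).
Context (Heps : iid_bernoulli_half_indep P G eps).

Let E := expR (3 * (rho * T)).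
Let kap := 2^-1 + 2 * theta.

Let E_gt1 : 1 < E.
Proof. by rewrite /E expR_gt1 !mulr_gt0. Qed.
Let kap_gt0 : 0 < kap. Proof. by rewrite ltr_pwDl ?invr_gt0 ?mulr_ge0. Qed.
Let near_lt1 : \forall n \near F, decay rho T n < 1.
Proof. by apply: filterS (near_gt0 HF) => n; exact: decay_lt1. Qed.

(** The quadratic sums are weighted by [theta], so that for [theta = 0] the three hypotheses hold
    without any information on the unweighted sums. *)
Lemma lim_equilibrium_cost (V W qn qo : R) : V != 0 -> W != 0 ->
  (\sum_(i < n.+1) nu_vec rho T theta n i 0) @[n --> F] --> V ->
  (\sum_(i < n.+1) omega_vec rho T theta n i 0) @[n --> F] --> W ->
  (theta * \sum_(i < n.+1) nu_vec rho T theta n i 0 ^+ 2) @[n --> F] --> qn ->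
  (theta * \sum_(i < n.+1) nu_vec rho T theta n i 0 * omega_vec rho T theta n i 0)
    @[n --> F] --> (0 : R) ->
  (theta * \sum_(i < n.+1) omega_vec rho T theta n i 0 ^+ 2) @[n --> F] --> qo ->
  expected_eq_cost P rho T theta x y S0 eps n @[n --> F] -->
    ((x + y) ^+ 2 / (6 * V) + (x ^+ 2 - y ^+ 2) / (2 * W)
     - (x + y) ^+ 2 * qn / (12 * V ^+ 2) + (x - y) ^+ 2 * qo / (4 * W ^+ 2))%:E.
Proof.
move=> V0 W0 lV lW lqn lX lqo.
pose v n := \sum_(i < n.+1) nu_vec rho T theta n i 0.
pose w n := \sum_(i < n.+1) omega_vec rho T theta n i 0.
pose p n := (x + y) / 2 / v n; pose q n := (x - y) / 2 / w n.
pose Qn n := \sum_(i < n.+1) nu_vec rho T theta n i 0 ^+ 2.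
pose X n := \sum_(i < n.+1) nu_vec rho T theta n i 0 * omega_vec rho T theta n i 0.
pose Qo n := \sum_(i < n.+1) omega_vec rho T theta n i 0 ^+ 2.
have lv : v n @[n --> F] --> V by [].
have lw : w n @[n --> F] --> W by [].
have lp : p n @[n --> F] --> (x + y) / 2 / V by rewrite /p; lim.
have lq : q n @[n --> F] --> (x - y) / 2 / W by rewrite /q; lim.
have l1 : theta * Qn n @[n --> F] --> qn by [].
have l2 : theta * X n @[n --> F] --> (0 : R) by [].
have l3 : theta * Qo n @[n --> F] --> qo by [].
pose c n := 2 / 3 * p n ^+ 2 * v n + 2 * p n * q n * v n
     - (p n ^+ 2 * (theta * Qn n) / 3 + 2 * p n * q n * (theta * X n)
       - q n ^+ 2 * (theta * Qo n)).
have lc : c n @[n --> F] --> (x + y) ^+ 2 / (6 * V) + (x ^+ 2 - y ^+ 2) / (2 * W)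
     - (x + y) ^+ 2 * qn / (12 * V ^+ 2) + (x - y) ^+ 2 * qo / (4 * W ^+ 2).
  by rewrite /c; lim; field; nonzero.
have lE : (c n)%:E @[n --> F] --> ((x + y) ^+ 2 / (6 * V)
     + (x ^+ 2 - y ^+ 2) / (2 * W)
     - (x + y) ^+ 2 * qn / (12 * V ^+ 2) + (x - y) ^+ 2 * qo / (4 * W ^+ 2))%:E.
  by apply: cvg_EFin lc; apply: nearW.
apply: cvg_trans lE; apply: near_eq_cvg; near=> n.
have n0 : (0 < n)%N by near: n; exact: near_gt0.
have vn : v n != 0 by near: n; apply: lim_neq0 lv V0.
have wn : w n != 0 by near: n; apply: lim_neq0 lw W0.
rewrite (equilibrium_expected_cost x y rho0 T0 theta0 n0 HG HS Heps vn wn).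
by congr EFin; rewrite /c /p /q /v /w /Qn /X /Qo; ring.
Unshelve. all: by end_near. Qed.

(** The range of [M] contains 0 and plus or minus [1 / E]; the first summand is positive and the
    others are nonnegative. *)
Let nu_limit_gt0 (M : R) : -1 <= M <= 1 -> 0 < 2 * E - M /\
  0 < rho * T / 3 + 4 * (1 + M) * (E - 1) / (9 * (2 * E - M))
    + (2 * E + 1) * (1 - M) / (3 * (2 * E - M)).
Proof.
move=> /andP[M1 M2]; have EM : 0 < 2 * E - M by move: E_gt1; lra.
split=> //; have s0 : 0 < rho * T by exact: mulr_gt0.
have t1 : 0 <= 4 * (1 + M) * (E - 1) / (9 * (2 * E - M)).
  rewrite divr_ge0 ?mulr_ge0 ?(ltW EM) //; move: E_gt1; lra.
have t2 : 0 <= (2 * E + 1) * (1 - M) / (3 * (2 * E - M)).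
  rewrite divr_ge0 ?mulr_ge0 ?(ltW EM) //; move: E_gt1; lra.
by rewrite ltr_wpDr // ltr_wpDr // divr_gt0.
Qed.

Lemma lim_cost_theta_gt0 : 0 < theta ->
  expected_eq_cost P rho T theta x y S0 eps n @[n --> F] -->
  ((x + y) ^+ 2 *
     (36 * expR (6 * rho * T) * (8 * rho * T + 13) - 60 * expR (3 * rho * T) - 3)
     / (16 * (2 * expR (3 * rho * T) * (3 * rho * T + 5) - 1) ^+ 2)
     + (x ^+ 2 - y ^+ 2) / (2 * (rho * T + 1))
     + (x - y) ^+ 2 / (16 * (rho * T + 1) ^+ 2))%:E.
Proof.
move=> thp; have la : decay rho T n @[n --> F] --> (1 : R) by exact: lim_decay.
have [m1 [m2 [roots mm lm1 lm2 le]]] := char_roots _ kap_gt0 la near_lt1.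
(* This amounts to [kap > 1/2], that is [theta > 0]. *)
have l1 : `|(kap - 1) / kap| < 1.
  rewrite normrM normfV (gtr0_norm kap_gt0) ltr_pdivrMr // mul1r.
  by rewrite ltr_norml /kap; lra.
have lm2n := lim_nX (FF := FF) HF l1 lm2.
have vanish (u : nat -> R) : u n @[n --> F] --> (kap - 1) / kap ->
    u n ^+ n.+1 @[n --> F] --> (0 : R).
  move=> ul; have i0 := lim_invn (R := R) HF; have un := lim_nX (FF := FF) HF l1 ul.
  apply: (@lim_near _ _ _ _ _ (fun n => n%:R^-1 * (n%:R * u n ^+ n) * u n)).
    apply: filterS (near_gt0 HF) => n n0; rewrite mulKf ?exprSr //.
    by rewrite pnatr_eq0 -lt0n.
  by lim; rewrite !mul0r.
have lm2X := vanish _ lm2.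
have lr : decay rho T n * (kap - 1) / kap @[n --> F] --> (kap - 1) / kap.
  by lim; rewrite mul1r.
have lrX := vanish _ lr.
have [EM0 V0] : 0 < 2 * E - 0 /\ _ := @nu_limit_gt0 0 ltac:(apply/andP; split; lra).
have EM := lt0r_neq0 EM0.
have lV := lim_nu_sum (FF := FF) HF rho0 T0 theta0 roots lm1 lm2 le lm2X EM.
have lW := lim_omega_sum (FF := FF) HF rho0 T0 theta0 lrX.
have lQn := lim_nu_sqr (FF := FF) HF rho0 T0 theta0 roots lm1 lm2 le lm2X EM l1 erefl.
have lX := lim_nu_omega (FF := FF) HF rho0 T0 theta0 roots lm1 lm2 le lm2X EM mm lm2n lrX erefl.
have lQo := lim_omega_sqr (FF := FF) HF rho0 T0 theta0 l1 lrX.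
have W0 : 0 < rho * T + 1 - 0 by rewrite subr0 addr_gt0 ?mulr_gt0.
apply: cvg_EFin_eq.
  apply: (lim_equilibrium_cost (lt0r_neq0 V0) (lt0r_neq0 W0) lV lW).
  - exact: (limM (cvg_cst theta) lQn).
  - by apply: (lim_eq (limM (cvg_cst theta) lX)); rewrite mulr0.
  - exact: (limM (cvg_cst theta) lQo).
have -> : expR (6 * rho * T) = E ^+ 2.
  by rewrite /E -expRM_natl; congr expR; ring.
have -> : expR (3 * rho * T) = E by rewrite /E mulrA.
have E0 : E != 0 by rewrite lt0r_neq0 // (lt_trans ltr01).
have D0 : 2 * E * (3 * rho * T + 5) - 1 != 0.
  have s0 : 0 < rho * T by exact: mulr_gt0.
  rewrite lt0r_neq0 //; have : 0 < E * (rho * T) by rewrite mulr_gt0 // (lt_trans ltr01).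
  move: E_gt1; lra.
have rT1 : rho * T + 1 != 0 by rewrite subr0 in W0; exact: lt0r_neq0.
have th0 := lt0r_neq0 thp.
rewrite -/E !subr0 !addr0 !mulr1.
(* This factor cancels the weight [theta], which is why the limit does not depend on [theta]. *)
have -> : 2 * (2^-1 + 2 * theta) - 1 = 4 * theta by field.
have -> : rho * T / 3 + 4 * (E - 1) / (9 * (2 * E)) + (2 * E + 1) / (3 * (2 * E))
    = (2 * E * (3 * rho * T + 5) - 1) / (18 * E) by field.
by field; nonzero.
Qed.

(** Here [kap = 1/2], the product of the roots is -1 and the omega ratio is [- decay rho T n]. The
    powers of order [n.+1] thus carry the sign (-1)^(n+1), which is fixed to [sg] along [F]. *)
Lemma lim_cost_theta_eq0 (sg : R) : theta = 0 -> sg = 1 \/ sg = -1 ->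
  (\forall n \near F, (-1) ^+ n.+1 = sg) ->
  let W := rho * T + 1 - sg * expR (- (rho * T)) in
  let V := rho * T / 3 + 4 * (1 + sg / E) * (E - 1) / (9 * (2 * E - sg / E))
    + (2 * E + 1) * (1 - sg / E) / (3 * (2 * E - sg / E)) in
  [/\ 0 < 2 * E - sg / E, 0 < V, 0 < W &
  expected_eq_cost P rho T theta x y S0 eps n @[n --> F] -->
  ((x + y) ^+ 2 / (6 * V) + (x ^+ 2 - y ^+ 2) / (2 * W))%:E].
Proof.
move=> th sg1 nsg W V; have la : decay rho T n @[n --> F] --> (1 : R) by exact: lim_decay.
have [m1 [m2 [roots mm lm1 lm2 le]]] := char_roots _ kap_gt0 la near_lt1.
have kE : (kap - 1) / kap = -1 by rewrite /kap th mulr0 addr0; field.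
have E0 : 0 < E by rewrite (lt_trans ltr01).
have E0' := lt0r_neq0 E0.
have lm1X : m1 n ^+ n.+1 @[n --> F] --> E by apply: lim_slow_rootX le.
have lm2X : m2 n ^+ n.+1 @[n --> F] --> sg / E.
  apply: (@lim_near _ _ _ _ _ (fun n => sg * (m1 n ^+ n.+1)^-1)); last by lim.
  near=> n.
  have m10 : m1 n != 0 by near: n; apply: lim_neq0 lm1 (oner_neq0 _).
  have mn : m1 n * m2 n = -1 by rewrite -kE; near: n.
  have -> : m2 n = -1 * (m1 n)^-1 by rewrite -mn mulrAC mulfV // mul1r.
  by rewrite exprMn exprVn; congr (_ * _); near: n.
have aX : decay rho T n ^+ n.+1 @[n --> F] --> expR (- (rho * T)) by exact: lim_decayX.
have lrX : (decay rho T n * (kap - 1) / kap) ^+ n.+1 @[n --> F] -->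
    sg * expR (- (rho * T)).
  apply: (@lim_near _ _ _ _ _ (fun n => sg * decay rho T n ^+ n.+1)); last by lim.
  near=> n; rewrite -mulrA kE mulrC exprMn; congr (_ * _); by near: n.
have sgE : -1 <= sg / E <= 1.
  rewrite ler_pdivrMr // ler_pdivlMr //; move: E_gt1.
  by case: sg1 => ->; move=> *; apply/andP; split; lra.
have [EM0 V0] := nu_limit_gt0 sgE.
have EM := lt0r_neq0 EM0.
have lV := lim_nu_sum (FF := FF) HF rho0 T0 theta0 roots lm1 lm2 le lm2X EM.
have lW := lim_omega_sum (FF := FF) HF rho0 T0 theta0 lrX.
have s0 : 0 < rho * T by exact: mulr_gt0.
have W0 : 0 < W.
  have : expR (- (rho * T)) < 1 by rewrite expR_lt1 oppr_lt0.
  have : 0 < expR (- (rho * T)) by exact: expR_gt0.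
  by rewrite /W; case: sg1 => ->; lra.
split=> //.
have z (f : nat -> R) : theta * f n @[n --> F] --> (0 : R).
  by rewrite th; under eq_fun do rewrite mul0r; exact: cvg_cst.
apply: cvg_EFin_eq.
  exact: (lim_equilibrium_cost (lt0r_neq0 V0) (lt0r_neq0 W0) lV lW (z _) (z _) (z _)).
by rewrite -/V; ring.
Unshelve. all: by end_near. Qed.

End CostLimit.

Theorem theorem3p2 (R : realType) (d : measure_display) (Omega : measurableType d)
    (P : probability Omega R) (F : R -> set (set Omega)) (S0 : R -> Omega -> R)
    (eps : nat -> Omega -> R) (rho T theta x y : R) :
  0 < rho -> 0 < T -> 0 <= theta ->
  filtration F -> right_continuous_filtration F -> trivial_at0 P F ->
  martingale P F S0 -> right_continuous_paths S0 ->
  iid_bernoulli_half_indep P F eps ->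
  (0 < theta ->
     (fun N : nat => expected_eq_cost P rho T theta x y S0 eps N) @ \oo -->
       ((x + y) ^+ 2 *
          (36 * expR (6 * rho * T) * (8 * rho * T + 13) - 60 * expR (3 * rho * T) - 3)
        / (16 * (2 * expR (3 * rho * T) * (3 * rho * T + 5) - 1) ^+ 2)
        + (x ^+ 2 - y ^+ 2) / (2 * (rho * T + 1))
        + (x - y) ^+ 2 / (16 * (rho * T + 1) ^+ 2))%:E) /\
  (theta = 0 ->
     ((fun N : nat => expected_eq_cost P rho T theta x y S0 eps (2 * N)%N) @ \oo -->
        ((x + y) ^+ 2 * (6 * expR (6 * rho * T) + 3)
         / (2 * (2 * expR (6 * rho * T) * (3 * rho * T + 5)
                 + expR (3 * rho * T) + 3 * rho * T + 7))
         + (x ^+ 2 - y ^+ 2) / (2 * (expR (- (rho * T)) + rho * T + 1)))%:E) /\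
     ((fun N : nat => expected_eq_cost P rho T theta x y S0 eps (2 * N).+1) @ \oo -->
        ((x + y) ^+ 2 * (6 * expR (6 * rho * T) - 3)
         / (2 * (2 * expR (6 * rho * T) * (3 * rho * T + 5)
                 - 3 * expR (3 * rho * T) - 3 * rho * T - 7))
         + (x ^+ 2 - y ^+ 2) / (2 * (- expR (- (rho * T)) + rho * T + 1)))%:E)).
Proof.
move=> rho0 T0 theta0 HF _ _ HS _ Heps.
(* Along such an index map the image of infinity is finer than infinity, so every limit above
   applies to it. *)
have lin (phi : nat -> nat) : (forall n, n <= phi n)%N -> phi n @[n --> \oo] `=>` \oo.
  move=> le A [N _ NA]; exists N => // n Nn; apply: NA => /=.
  exact: leq_trans Nn (le n).
have E6 : expR (6 * rho * T) = expR (3 * (rho * T)) ^+ 2.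
  by rewrite -expRM_natl; congr expR; ring.
have E3 : expR (3 * rho * T) = expR (3 * (rho * T)) by rewrite mulrA.
have E0 : expR (3 * (rho * T)) != 0 by rewrite lt0r_neq0 ?expR_gt0.
split=> [thp|th0].
  exact: (@lim_cost_theta_gt0 R \oo _ (fun A HA => HA) _ _ _ _ _ _ _ _ _ _ _
    rho0 T0 theta0 HF HS Heps thp).
have n2 n : (n <= 2 * n)%N by rewrite leq_pmull.
have n21 n : (n <= (2 * n).+1)%N by rewrite ltnW // ltnS leq_pmull.
have parity (b : bool) n : (-1) ^+ (b + 2 * n) = (-1) ^+ b :> R.
  by rewrite exprD exprM sqrrN !expr1n mulr1.
split.
(* Even grids have an odd number of points, hence the sign -1. *)
- have [||EM V0 W0 l] := @lim_cost_theta_eq0 R ((2 * n)%N @[n --> \oo]) _ (lin _ n2)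
    _ _ _ _ _ _ _ _ _ x y rho0 T0 theta0 HF HS Heps (-1) th0.
  + by right.
  + by exists 0%N => // n _ /=; rewrite -[(2 * n).+1]add1n (parity true) expr1.
  move: l EM V0 W0; rewrite E6 E3; set E := expR _ in E0 * => l EM V0 W0.
  (* The denominators are nonzero by the positivity facts [EM] and [V0], once the fractions in [E]
     are cleared. *)
  have K0 : 2 * E ^+ 2 + 1 != 0.
    have := lt0r_neq0 EM; have -> : 2 * E - -1 / E = (2 * E ^+ 2 + 1) / E by field.
    by apply: contra => /eqP ->; rewrite mul0r.
  (* [N] is half the denominator of the claimed first term. *)
  set N := 2 * E ^+ 2 * (3 * rho * T + 5) + E + 3 * rho * T + 7.
  have VE : rho * T / 3 + 4 * (1 + -1 / E) * (E - 1) / (9 * (2 * E - -1 / E))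
      + (2 * E + 1) * (1 - -1 / E) / (3 * (2 * E - -1 / E)) = N / (9 * (2 * E ^+ 2 + 1)).
    by rewrite /N; field; nonzero.
  rewrite VE in V0 l *.
  have N0 : N != 0 by apply: contraTneq V0 => ->; rewrite mul0r ltxx.
  apply: (cvg_EFin_eq l).
  have W1 := lt0r_neq0 W0.
  have -> : expR (- (rho * T)) + rho * T + 1 = rho * T + 1 - -1 * expR (- (rho * T)) by ring.
  by field; nonzero.
(* Odd grids have an even number of points, hence the sign 1. *)
- have [||EM V0 W0 l] := @lim_cost_theta_eq0 R ((2 * n).+1 @[n --> \oo]) _ (lin _ n21)
    _ _ _ _ _ _ _ _ _ x y rho0 T0 theta0 HF HS Heps 1 th0.
  + by left.
  + by exists 0%N => // n _ /=; rewrite -[(2 * n).+2]add2n -mulnS -[(2 * _)%N]add0n (parity false).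
  move: l EM V0 W0; rewrite E6 E3; set E := expR _ in E0 * => l EM V0 W0.
  have K0 : 2 * E ^+ 2 - 1 != 0.
    have := lt0r_neq0 EM; have -> : 2 * E - 1 / E = (2 * E ^+ 2 - 1) / E by field.
    by apply: contra => /eqP ->; rewrite mul0r.
  set N := 2 * E ^+ 2 * (3 * rho * T + 5) - 3 * E - 3 * rho * T - 7.
  have VE : rho * T / 3 + 4 * (1 + 1 / E) * (E - 1) / (9 * (2 * E - 1 / E))
      + (2 * E + 1) * (1 - 1 / E) / (3 * (2 * E - 1 / E)) = N / (9 * (2 * E ^+ 2 - 1)).
    by rewrite /N; field; nonzero.
  rewrite VE in V0 l *.
  have N0 : N != 0 by apply: contraTneq V0 => ->; rewrite mul0r ltxx.
  apply: (cvg_EFin_eq l).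
  have W1 := lt0r_neq0 W0; rewrite mul1r in W1.
  have -> : - expR (- (rho * T)) + rho * T + 1 = rho * T + 1 - expR (- (rho * T)) by ring.
  by field; nonzero.
Qed.
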